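(* Let $\mathbb{D}$ be a skew field, $d\ge 2$, and let $(V,\mathcal{P},\mathcal{B})$ be a $\mathrm{TD}(k,n)$, $n\ge 3$, $k\ge 4$, with a proper embedding into $P^d(\mathbb{D})$ on hyperplanes $H_1,H_2,\dots,H_k$. Then $\dim(H_1\cap H_2\cap\dots\cap H_k)=d-2$, and homogeneous coordinates can be chosen such that there exist a subgroup $G$ of $(\mathbb{D}^{d-1},+)$ of order $n$ and distinct $a_4,\dots,a_k\in\mathbb{D}_G\setminus\{0,1\}$ with $H_1,H_2,H_3$ having equations $x_d=0$, $x_d=x_{d+1}$, $x_{d+1}=0$, respectively, $$H_1\cap V=\{[\boldsymbol{\gamma},0,1]:\boldsymbol{\gamma}\in G\},\quad H_2\cap V=\{[\boldsymbol{\gamma},1,1]:\boldsymbol{\gamma}\in G\},\quad H_3\cap V=\{[-\boldsymbol{\gamma},1,0]:\boldsymbol{\gamma}\in G\},$$ and $$H_i\cap V=\{[\boldsymbol{\gamma},a_i,1]:\boldsymbol{\gamma}\in G\},\quad i=4,\dots,k.$$ Furthermore, $n$ is a prime power $p^m$, $G$ is isomorphic to $\mathbb{Z}_p^m$, $|\mathbb{D}_G|=p^t$ for some $t\le m$, and $k\le|\mathbb{D}_G|+1$. In particular, if a Latin square of side $n$ with transversal (that is, a $\mathrm{TD}(3,n)$ with a transversal point) is properly embedded into $P^d(\mathbb{D})$, with associated group $G$, then the Latin square can be extended to a $\mathrm{TD}(|\mathbb{D}_G|+1,n)$ with an embedding into $P^d(\mathbb{D})$ that extends the original embedding.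
   Context: A transversal design $\mathrm{TD}(k,n)$, with $n\ge 3$, $k\ge 3$, is a triple $(V,\mathcal{P},\mathcal{B})$ where $V$ is a set of size $kn$, $\mathcal{P}$ is a partition of $V$ into $k$ subsets of size $n$ (called parts), and $\mathcal{B}$ is a set of $k$-subsets of $V$ (called blocks), such that any two distinct elements of $V$ are contained in either a unique part or a unique block, but not both. (A Latin square of side $n$ is equivalent to a $\mathrm{TD}(3,n)$.) A $\mathrm{TD}(k',n)$ $(V',\mathcal{P}',\mathcal{B}')$ extends $(V,\mathcal{P},\mathcal{B})$ if $V\subseteq V'$, $\mathcal{P}\subseteq\mathcal{P}'$ and $\mathcal{B}=\{B'\cap V : B'\in\mathcal{B}'\}$. For a skew field $\mathbb{D}$, $\mathbb{D}^{m}$ is regarded as a right vector space: $(x_1,\dots,x_m)\alpha=(x_1\alpha,\dots,x_m\alpha)$. $P^d(\mathbb{D})$ is the $d$-dimensional projective space of one-dimensional subspaces of the right vector space $\mathbb{D}^{d+1}$; $[x_1,\dots,x_{d+1}]$ denotes the point with those homogeneous coordinates (with respect to some basis of $\mathbb{D}^{d+1}$). Here $[\boldsymbol{x},y,z]$ has $\boldsymbol{x}\in\mathbb{D}^{d-1}$, $y,z\in\mathbb{D}$, and $\boldsymbol{o}$ is the zero vector of $\mathbb{D}^{d-1}$. Hyperplanes are $(d-1)$-flats, with equations $\alpha_1x_1+\dots+\alpha_{d+1}x_{d+1}=0$, not all $\alpha_i=0$. Dimension is projective dimension. A $\mathrm{TD}(k,n)$ $(V,\mathcal{P},\mathcal{B})$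 is embedded in $P^d(\mathbb{D})$ on the hyperplanes $H_1,\dots,H_k$ if (after identifying $V$ with its image) $V\subseteq P^d(\mathbb{D})$, the hyperplanes $H_i$ are distinct, $\mathcal{P}=\{V\cap H_1,\dots,V\cap H_k\}$, every block $B$ is contained in a line $\ell_B$ of $P^d(\mathbb{D})$, the lines $\ell_B$ ($B\in\mathcal{B}$) are distinct, and no $\ell_B$ is contained in any $H_i$. The embedding is proper if $V$ does not lie on a hyperplane. A transversal point of an embedded $\mathrm{TD}(3,n)$ is a point $\infty\in P^d(\mathbb{D})$ for which there is a partition of $V$ into $n$ pairwise disjoint blocks $B_1,\dots,B_n$ such that the lines $\ell_{B_1},\dots,\ell_{B_n}$ all pass through $\infty$. If a $\mathrm{TD}(3,n)$ with a transversal point is properly embedded on $H_1,H_2,H_3$, then $\dim(H_1\cap H_2\cap H_3)=d-2$, and its associated group $G$ is obtained as follows: choose $1_1\in H_1\cap V$, $1_2\in H_2\cap V$, let $1_3$ be the point of $H_3\cap V$ on the block through $1_1,1_2$, and choose homogeneous coordinates with $H_1\cap H_2\cap H_3=\{[\boldsymbol{x},0,0]:\boldsymbol{x}\in\mathbb{D}^{d-1}\}$, $1_1=[\boldsymbol{o},0,1]$, $1_2=[\boldsymbol{o},1,1]$, $1_3=[\boldsymbol{o},1,0]$; then $G=\{\boldsymbol{\gamma}\in\mathbb{D}^{d-1}:[\boldsymbol{\gamma},0,1]\in V\}$, which is a subgroup of $(\mathbb{D}^{d-1},+)$ of order $n$. For a finite subgroup $G$ of $(\mathbb{D}^{d-1},+)$,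 $\mathbb{D}_G=\{a\in\mathbb{D} : Ga\subseteq G\}$, which is a subfield of $\mathbb{D}$ when $G$ is nontrivial. *)

(* Defs.v *)
From mathcomp Require Export all_boot all_order all_algebra.
From mathcomp Require Export boolp classical_sets functions cardinality.

Set Implicit Arguments.
Unset Strict Implicit.
Unset Printing Implicit Defensive.
Import GRing.Theory.
Local Open Scope classical_set_scope.
Local Open Scope ring_scope.

(* A skew field is a unitRingType D with [GRing.field_axiom D] (every nonzero
   element is invertible); multiplication in a unitRingType need not commute. *)

Section Geometry.
Variable D : unitRingType.

(* D^m is the right vector space of columns. The library's scaling [a *: v]
   multiplies on the left, hence this separate operation. *)
Definition rscale m (v : 'cV[D]_m) (a : D) : 'cV[D]_m := \col_i (v i 0 * a).

(* [A *m c] is the right linear combination of the columns of A with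
   coefficients c, so this is the right span of the columns of A. *)
Definition colspan m e (A : 'M[D]_(m, e)) : set 'cV[D]_m :=
  range (fun c : 'cV[D]_e => A *m c).

Definition col_indep m e (A : 'M[D]_(m, e)) : Prop :=
  forall c : 'cV[D]_e, A *m c = 0 -> c = 0.

(* U is a right linear subspace of D^m of linear dimension e. *)
Definition subspace m e (U : set 'cV[D]_m) : Prop :=
  exists2 A : 'M[D]_(m, e), col_indep A & U = colspan A.

Definition is_basis m (A : 'M[D]_m) : Prop :=
  col_indep A /\ colspan A = [set: 'cV[D]_m].

(* The points of P^d(D). *)
Record ppoint d := PPoint {
  vecs : set 'cV[D]_d.+1;
  vecs_dim1 : subspace 1 vecs }.

(* Flats are sets of points; e is the projective dimension. *)
Definition is_flat d e (F : set (ppoint d)) : Prop :=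
  exists2 U : set 'cV[D]_d.+1, subspace e.+1 U & F = [set p | vecs p `<=` U].

Definition is_line d (F : set (ppoint d)) : Prop := is_flat 1 F.

(* Meaningful for d > 0 only, because of d.-1. *)
Definition is_hyperplane d (F : set (ppoint d)) : Prop := is_flat d.-1 F.

(* The column (x, y, z) of D^(d+1), with x in D^(d-1); meaningful for d > 0. *)
Definition hvec d (x : 'cV[D]_d.-1) (y z : D) : 'cV[D]_d.+1 :=
  \col_(i < d.+1)
    if insub (i : nat) is Some j then x j 0
    else if (i : nat) == d.-1 then y else z.

(* p = [x, y, z] with respect to the basis of D^(d+1) formed by the columns of
   M. This fails for every p when x, y, z all vanish, since the right-hand side
   is then the zero subspace. *)
Definition has_coords d (M : 'M[D]_d.+1) (x : 'cV[D]_d.-1) (y z : D)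
    (p : ppoint d) : Prop :=
  vecs p = colspan (M *m hvec x y z).

(* The set of points all of whose homogeneous coordinates (x, y, z) satisfy
   E x y z; used for homogeneous equations E. *)
Definition locus d (M : 'M[D]_d.+1) (E : 'cV[D]_d.-1 -> D -> D -> Prop) :
    set (ppoint d) :=
  [set p | forall x y z, has_coords M x y z p -> E x y z].

Definition is_subgroup m (G : set 'cV[D]_m) : Prop :=
  G 0 /\ (forall x y, G x -> G y -> G (x - y)).

(* D_G *)
Definition stab_scalars m (G : set 'cV[D]_m) : set D :=
  [set a | forall g, G g -> G (rscale g a)].

End Geometry.

Section TransversalDesigns.
Variable T : Type.
Implicit Types (V : set T) (P B : set (set T)).
Local Open Scope nat_scope.
Local Open Scope card_scope.

Definition is_TD (k n : nat) V P B : Prop :=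
  [/\ 3 <= k /\ 3 <= n,
      V #= `I_(k * n),
      [/\ partition P id V, P #= `I_k & forall A, P A -> A #= `I_n],
      forall b, B b -> b `<=` V /\ b #= `I_k
    & forall x y, V x -> V y -> x <> y ->
        ((exists! A, P A /\ A x /\ A y) /\ ~ (exists b, B b /\ b x /\ b y)) \/
        (~ (exists A, P A /\ A x /\ A y) /\ (exists! b, B b /\ b x /\ b y))].

Definition TD_extends V P B V' P' B' : Prop :=
  [/\ V `<=` V', P `<=` P' & B = [set b `&` V | b in B']].

End TransversalDesigns.

Section Embeddings.
Variables (D : unitRingType) (d : nat).
Local Notation pt := (ppoint D d).
Implicit Types (V : set pt) (P B : set (set pt)).
Implicit Types (H : nat -> set pt) (ell : set pt -> set pt).
Local Open Scope nat_scope.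
Local Open Scope card_scope.

(* Hyperplanes H_1, ..., H_k are the values H 1, ..., H k of a function on nat;
   the other values are irrelevant. *)
Definition index_range (i k : nat) : set nat := [set j | i <= j <= k].

(* (V, P, B), already identified with its image, is embedded on H 1, ..., H k;
   the line of a block b is ell b. *)
Definition embedded (k : nat) V P B H ell : Prop :=
  [/\ (forall i, index_range 1 k i -> is_hyperplane (H i))
        /\ set_inj (index_range 1 k) H,
      P = [set V `&` H i | i in index_range 1 k],
      forall b, B b -> is_line (ell b) /\ b `<=` ell b,
      set_inj B ell
    & forall b i, B b -> index_range 1 k i -> ~ (ell b `<=` H i)].

Definition is_proper V : Prop :=
  forall F : set pt, is_hyperplane F -> ~ (V `<=` F).

Definition is_transversal_point (n : nat) V B ell (infty : pt) : Prop :=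
  exists Q : set (set pt),
    [/\ Q `<=` B, partition Q id V, Q #= `I_n
      & forall b, Q b -> ell b infty].

(* G is the associated group of a TD(3,n) embedded on H 1, H 2, H 3, for some
   admissible choice of the points 1_1, 1_2, 1_3 (here o1, o2, o3) and of
   homogeneous coordinates. *)
Definition is_associated_group V B H (G : set 'cV[D]_d.-1) : Prop :=
  exists (o1 o2 o3 : pt) (M : 'M[D]_d.+1),
    [/\ [/\ (V `&` H 1) o1, (V `&` H 2) o2, (V `&` H 3) o3
          & exists b, [/\ B b, b o1, b o2 & b o3]],
        is_basis M,
        H 1 `&` H 2 `&` H 3 = [set p | exists x, has_coords M x 0%R 0%R p],
        [/\ has_coords M 0%R 0%R 1%R o1,
            has_coords M 0%R 1%R 1%R o2
          & has_coords M 0%R 1%R 0%R o3]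
      & G = [set g | exists2 p, V p & has_coords M g 0%R 1%R p]].

End Embeddings.

(* Main.v *)
Require Import Defs.
From HB Require Import structures.
From mathcomp Require Import all_boot all_order all_algebra.
From mathcomp Require Import finmap fingroup perm cyclic pgroup sylow.
From mathcomp Require Import boolp classical_sets functions cardinality.

(* A block is determined by its points on H_1 and H_2. Once H_1, H_2, H_3 share
   a codimension 2 flat, collinearity of [x, 0, 1], [y, 1, 1], [-z, 1, 0] reads
   z = x - y, so that each of the three parts is a copy of one additive group
   G. A fourth part on the hyperplane y = a z then satisfies
   G (1 - a) + G a = G, that is, a stabilises G; conversely, the parts
   {[g, a, 1] : g in G} for all a in D_G extend the design.

   The crucial point is that k >= 4 forces H_3 to contain the intersection of
   H_1 and H_2. Let V_i be the part on H_i. Otherwise choose forms f_i defining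
   H_i, all taking the value 1 at a point of V_4. The finite subsets
   A = (f_2 / f_3)(V_1), B = (f_3 / f_1)(V_2), C = (f_1 / f_2)(V_3) of the
   multiplicative group of D satisfy A b = a B = - C^-1 for all a in A, b in B
   (Menelaus) and B = 1 - A^-1 (perspective from the point of V_4). If |A| = 1,
   then V lies on a hyperplane. If |A| > 1, then A is a coset of a finite
   multiplicative group and sum A^-1 = sum B = 0, so |A| = 0 in D; but in
   characteristic p > 0 a finite multiplicative group has no element of order p,
   as (g - 1)^p = g^p - 1, contradicting Cauchy's theorem. *)

Set Implicit Arguments.
Unset Strict Implicit.
Unset Printing Implicit Defensive.
Import GRing.Theory.
Local Open Scope classical_set_scope.
Local Open Scope ring_scope.
Local Open Scope card_scope.

(** * Finite sets of equal cardinality *)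

(** Three parts alone can realise a finite multiplicative group on a triangle of hyperplanes, so the
    coaxial case cannot be reached without a fourth part: a point of it is a centre of perspectivity
    between the parts on [H_1] and [H_2], which forces the additive relation [B = 1 - A^-1] on
    multiplicative data. Forms act on the left and scalars on the right, so a ratio [f(v) / g(v)] is
    unchanged when [v] is rescaled, and every product of such ratios has to be kept in its order.
    The bound on [k] counts a pencil of hyperplanes: [0, 1, a_4, ..., a_k] are distinct elements of
    [D_G], and [z = 0] is one hyperplane more. The extension keeps the lines of the old blocks. The
    line through [[g, 0, 1]] and [[t, 1, 0]] meets [y = h z] in [[g + t h, h, 1]], and [g + t h]
    stays in [G] for [h] in [D_G]. Conversely, points [p], [q] at heights [h], [h'] determine
    [t = (p - q)(h - h')^-1], which lies in [G] because [D_G] is closed under differences and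
    inverses. *)

Lemma card_sub_eq (T : Type) (A B : set T) n :
  A `<=` B -> A #= `I_n -> B #= `I_n -> A = B.
Proof.
(* Counting with finite sets requires a [choiceType]; [{classic T}] makes one of any type. *)
suff H (U : choiceType) (A' B' : set U) :
    A' `<=` B' -> A' #= `I_n -> B' #= `I_n -> A' = B'.
  exact: (H {classic T}).
move=> AB An Bn.
have AF : finite_set A' by apply/finite_setP; exists n.
have BF : finite_set B' by apply/finite_setP; exists n.
apply: fset_set_inj => //; apply/eqP; rewrite eqEfcard.
rewrite (card_fset_set An) (card_fset_set Bn) leqnn andbT.
by rewrite -fset_set_sub.
Qed.

Lemma card_inj_image (T U : Type) (A : set T) (f : T -> U) n :
  set_inj A f -> A #= `I_n -> f @` A #= `I_n.
Proof. by move=> fi An; apply: card_eq_trans An; apply: inj_card_eq. Qed.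

(** If [x] and [y] collide, dropping [y] leaves the image unchanged, so [A] without [y] still has
    [n] elements and must be all of [A]. *)
Lemma card_surj_inj (T U : Type) (A : set T) (f : T -> U) n :
  A #= `I_n -> f @` A #= `I_n -> set_inj A f.
Proof.
move=> An Bn x y /set_mem Ax /set_mem Ay fxy.
apply: contrapT => xy.
have fE : f @` (A `\ y) = f @` A.
  apply/seteqP; split=> [_ [z [Az _] <-]|_ [z Az <-]]; first by exists z.
  have [->|zy] := pselect (z = y); last by exists z.
  by exists x => //; split=> // /esym /esym.
have AyE : A `\ y #= `I_n.
  rewrite card_eq_le; apply/andP; split.
    apply: card_le_trans (subset_card_le (@subDsetl _ A [set y])) _.
    by move: An; rewrite card_eq_le => /andP[].
  apply: card_le_trans (card_image_le f (A `\ y)).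
  by rewrite fE; move: Bn; rewrite card_eq_le => /andP[].
have /seteqP[_ /(_ _ Ay)] := card_sub_eq (@subDsetl _ A [set y]) AyE An.
by case=> _; apply.
Qed.

(** * Finite multiplicative sets in a skew field *)

Section SkewField.
Variable D : unitRingType.
Hypothesis hD : GRing.field_axiom D.

Lemma skew_mulf_eq0 (x y : D) : x * y = 0 -> x = 0 \/ y = 0.
Proof.
have [->|/hD ux] := eqVneq x 0; first by left.
by move=> xy; right; rewrite -[y](mulKr ux) xy mulr0.
Qed.

Lemma skew_mul_neq0 (x y : D) : x != 0 -> y != 0 -> x * y != 0.
Proof.
by move=> x0 y0; apply/eqP => /skew_mulf_eq0[] /eqP; apply/negP.
Qed.

Lemma skew_inv_neq0 (x : D) : x != 0 -> x^-1 != 0.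
Proof.
move=> x0; apply/eqP => xV; have := mulrV (hD x0).
by rewrite xV mulr0 => /esym/eqP; apply/negP/oner_neq0.
Qed.

Lemma skew_invM (x y : D) : x != 0 -> y != 0 -> (x * y)^-1 = y^-1 * x^-1.
Proof. by move=> /hD ux /hD uy; apply: invrM. Qed.

Lemma skew_mulIf (c : D) : c != 0 -> injective (fun x => x * c).
Proof. by move=> /hD cu; apply: mulIr. Qed.

Lemma skew_mulfI (c : D) : c != 0 -> injective (fun x => c * x).
Proof. by move=> /hD cu; apply: mulrI. Qed.

(** Split off the least prime factor: without zero divisors, either it or the cofactor vanishes in
    [D]. That the characteristic divides [n] is what makes Cauchy's theorem applicable later. *)
Lemma skew_pchar n : (0 < n)%N -> n%:R = 0 :> D ->
  exists2 p, (p %| n)%N & p \in [pchar D].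
Proof.
elim/ltn_ind: n => n IHn n0 nD.
have n1 : (1 < n)%N.
  case: n n0 nD {IHn} => [|[|n]] // _ /eqP; by rewrite oner_eq0.
have := divnK (pdiv_dvd n); rewrite mulnC => nE.
have q0 : (0 < n %/ pdiv n)%N by rewrite divn_gt0 ?pdiv_gt0 // dvdn_leq // pdiv_dvd.
move: nD; rewrite -{1}nE natrM => /skew_mulf_eq0[pD|qD].
  exists (pdiv n); first exact: pdiv_dvd.
  by rewrite inE pdiv_prime //= pD.
have [|p pq pD] := IHn _ _ q0 qD; first by rewrite ltn_Pdiv // prime_gt1 // pdiv_prime.
exists p => //; apply: dvdn_trans pq _.
by rewrite -[X in (_ %| X)%N]nE dvdn_mull.
Qed.

(* The Frobenius map turns [g ^+ p = 1] into [(g - 1) ^+ p = 0]. *)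
Lemma skew_pchar_unipotent p (g : D) :
  p \in [pchar D] -> g ^+ p = 1 -> g = 1.
Proof.
move=> pD gp; apply: contrapT => /eqP; rewrite -subr_eq0 => g1.
have : (g - 1) ^+ p = 0.
  rewrite -(pFrobenius_autE pD).
  rewrite pFrobenius_autB_comm; last exact: commr1.
  by rewrite !pFrobenius_autE gp expr1n subrr.
elim: (p) => [/eqP|m IHm]; first by rewrite expr0 oner_eq0.
by rewrite exprS => /skew_mulf_eq0[/eqP|//]; rewrite (negPf g1).
Qed.

(** Closure under [z * (x^-1 * y)] says that [A] is a coset [x0 * K] of a finite multiplicative
    group [K]. To apply Cauchy's theorem, [K] is realised by its right translations of [A], a
    permutation group of order [size A]. *)
Lemma natr_card_coset_neq0 (A : seq D) : uniq A -> A != [::] -> 0 \notin A ->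
  {in A & &, forall x y z, z * (x^-1 * y) \in A} -> (size A)%:R != 0 :> D.
Proof.
move=> uA nA A0 Aheap; apply/eqP => sA0.
have nz x : x \in A -> x != 0 by apply: contraTneq => ->.
have [x0 Ax0] : exists x, x \in A.
  by case: A nA {uA A0 Aheap sA0 nz} => // x s _; exists x; rewrite mem_head.
have u0 := hD (nz _ Ax0).
pose T := seq_sub A.
(* [h y] is right multiplication by [x0^-1 * y]. *)
pose h (y z : T) : T := SeqSub (Aheap _ _ _ Ax0 (ssvalP y) (ssvalP z)).
have h_inj y : injective (h y).
  move=> z z' /(congr1 val) /= zz; apply: val_inj; apply: skew_mulIf zz.
  by rewrite skew_mul_neq0 ?skew_inv_neq0 ?nz ?ssvalP.
pose s y := perm (@h_inj y).
have s_inj : injective s.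
  move=> y y' /permP /(_ (SeqSub Ax0)); rewrite !permE => /(congr1 val) /=.
  by rewrite !mulVKr // => /val_inj.
pose G := [set s y | y in [set: T]]%SET.
have gG : group_set G.
  apply/group_setP; split=> [|_ _ /imsetP[y _ ->] /imsetP[y' _ ->]].
    apply/imsetP; exists (SeqSub Ax0); rewrite ?inE //.
    by apply/permP => z; rewrite perm1 permE; apply: val_inj; rewrite /= mulVr ?mulr1.
  apply/imsetP; exists (h y' y); rewrite ?inE //.
  by apply/permP => z; rewrite permM !permE; apply: val_inj; rewrite /= !mulrA.
have cG : #|group gG| = size A.
  by rewrite card_imset // cardsT card_seq_sub.
have sA : (0 < size A)%N by rewrite lt0n size_eq0.
have [p pA pD] := skew_pchar sA sA0.
have pp := pcharf_prime pD.
have [] := @Cauchy _ p (group gG) pp; first by rewrite cG.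
move=> _ /imsetP[y _ ->] sp.
have sX n z : val ((s y ^+ n)%g z) = val z * (x0^-1 * val y) ^+ n.
  elim: n z => [|n IHn] z; first by rewrite expg0 perm1 expr0 mulr1.
  by rewrite expgS permM IHn permE /= exprS -!mulrA.
have : x0^-1 * val y = 1.
  apply: (skew_pchar_unipotent pD); apply: (mulrI u0); rewrite mulr1.
  by have := sX p (SeqSub Ax0); rewrite -[X in (s y ^+ X)%g]sp expg_order perm1.
move=> yx0; have s1 : s y = 1%g.
  by apply/permP => z; rewrite perm1 permE; apply: val_inj; rewrite /= yx0 mulr1.
by move: sp pp; rewrite s1 order1 => <-.
Qed.

(* If [A b] does not depend on [b] in [B], then [sum A^-1 = 0], and dually
   [sum B = 0]; hence [B = 1 - A^-1] forces [|A| = 0] in D. *)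
Lemma no_product_triangle (A B : seq D) (E : D -> Prop) :
  uniq A -> uniq B -> 0 \notin A -> 0 \notin B -> (1 < size A)%N ->
  (forall b, b \in B -> forall e, E e <-> exists2 a, a \in A & e = a * b) ->
  (forall a, a \in A -> forall e, E e <-> exists2 b, b \in B & e = a * b) ->
  B =i [seq 1 - a^-1 | a <- A] -> False.
Proof.
move=> uA uB A0 B0 sA EA EB BA.
have nzA x : x \in A -> x != 0 by apply: contraTneq => ->.
have nzB x : x \in B -> x != 0 by apply: contraTneq => ->.
have uBA : uniq [seq 1 - a^-1 | a <- A].
  by rewrite map_inj_uniq // => x y /addrI /oppr_inj /invr_inj.
have pBA : perm_eq B [seq 1 - a^-1 | a <- A] by rewrite uniq_perm.
have sB : (1 < size B)%N by rewrite (perm_size pBA) size_map.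
have two (S : seq D) : uniq S -> (1 < size S)%N ->
    exists x y, [/\ x \in S, y \in S & x != y].
  case: S => [|x [|y S]] //= /andP[xS _] _; exists x, y.
  by rewrite !inE !eqxx orbT; move: xS; rewrite inE negb_or => /andP[].
have memE b : b \in B -> [seq a * b | a <- A] =i (fun e => `[< E e >]).
  move=> Bb e; apply/mapP/asboolP => /=; first by move/(EA b Bb).
  by move/(EA b Bb).
have memE' a : a \in A -> [seq a * b | b <- B] =i (fun e => `[< E e >]).
  move=> Aa e; apply/mapP/asboolP => /=; first by move/(EB a Aa).
  by move/(EB a Aa).
have sumAV : \sum_(a <- A) a^-1 = 0.
  have [b [b' [Bb Bb' bb']]] := two B uB sB.
  have pA : perm_eq [seq a * b | a <- A] [seq a * b' | a <- A].
    apply: uniq_perm => [||e]; last by rewrite !memE.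
      by rewrite map_inj_uniq //; apply/skew_mulIf/nzB.
    by rewrite map_inj_uniq //; apply/skew_mulIf/nzB.
  (* Inverting reverses the product, so that [c^-1] factors out on the left; comparing [b] with [b']
     then gives [(b^-1 - b'^-1) * sum A^-1 = 0]. *)
  have sumE c : c \in B ->
      \sum_(e <- [seq a * c | a <- A]) e^-1 = c^-1 * \sum_(a <- A) a^-1.
    move=> Bc; rewrite big_map mulr_sumr; apply: eq_big_seq => a Aa.
    by apply: skew_invM; [apply: nzA|apply: nzB].
  have := perm_big _ pA (F := fun e => e^-1) (P := xpredT) (op := +%R) (x := 0).
  rewrite !sumE // => /eqP; rewrite -subr_eq0 -mulrBl => /eqP /skew_mulf_eq0[]//.
  by move/eqP; rewrite subr_eq0 => /eqP /invr_inj /eqP; rewrite (negPf bb').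
have sumB : \sum_(b <- B) b = 0.
  have [a [a' [Aa Aa' aa']]] := two A uA sA.
  have pB : perm_eq [seq a * b | b <- B] [seq a' * b | b <- B].
    apply: uniq_perm => [||e]; last by rewrite !memE'.
      by rewrite map_inj_uniq //; apply/skew_mulfI/nzA.
    by rewrite map_inj_uniq //; apply/skew_mulfI/nzA.
  have := perm_big _ pB (F := id) (P := xpredT) (op := +%R) (x := 0).
  rewrite !big_map -!mulr_sumr => /eqP; rewrite -subr_eq0 -mulrBl.
  by move=> /eqP/skew_mulf_eq0[/eqP|//]; rewrite subr_eq0 (negPf aa').
have : (size A)%:R = 0 :> D.
  move: sumB; rewrite (perm_big _ pBA) /= big_map sumrB sumAV subr0.
  by rewrite big_const_seq count_predT iter_addr_0.
apply/eqP/natr_card_coset_neq0 => //; first by case: (A) sA.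
(* Both [A * b] and [x * B] are the product set [E]. Writing [y * b = x * b1] and then
   [z * b1 = a * b] gives [z * (x^-1 * y) = a]. *)
move=> x y z Ax Ay Az; have [b [_ [Bb _ _]]] := two B uB sB.
have /(EB x Ax) [b1 Bb1 yb] : E (y * b) by apply/(EA b Bb); exists y.
have /(EA b Bb) [a Aa zb] : E (z * b1) by apply/(EA b1 Bb1); exists z.
have ub := hD (nzB _ Bb).
suff -> : x^-1 * y = b1 / b by rewrite mulrA zb mulrK.
have ux := hD (nzA _ Ax).
by apply: (mulrI ux); rewrite mulVKr // mulrA -yb mulrK.
Qed.

End SkewField.

(** * Finite additive groups of prime exponent *)

Lemma card_finType (T : finType) : [set: T] #= `I_#|T|.
Proof.
have -> : [set: T] = enum_val @` [set: 'I_#|T|].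
  by apply/seteqP; split=> // x _; exists (enum_rank x); rewrite ?enum_rankK.
apply: card_inj_image; last by rewrite card_eq_sym card_II.
by move=> i j _ _; apply: enum_val_inj.
Qed.

Lemma zmod_closed_mulrn (V : zmodType) (S : set V) n x : S 0 ->
  (forall x y, S x -> S y -> S (x - y)) -> S x -> S (x *+ n).
Proof.
move=> S0 SB Sx; elim: n => [|n IHn]; first by rewrite mulr0n.
by rewrite mulrSr -[x in _ + x]opprK; apply: (SB) => //; rewrite -sub0r; apply: SB.
Qed.

Section ElementaryAbelian.
Variables (V : zmodType) (p : nat).
Hypothesis p_pr : prime p.

(** [(Zp_trunc p).+2] is the modulus with which ['Z_p] computes; it equals [p] as soon as
    [p > 1]. *)
Lemma Zp_mulrn (g : V) n : g *+ p = 0 -> g *+ (n %% (Zp_trunc p).+2)%N = g *+ n.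
Proof.
move=> gp; rewrite Zp_cast ?prime_gt1 // {2}(divn_eq n p) mulrnDr.
by rewrite mulnC mulrnA gp mul0rn add0r.
Qed.

(** The new first coordinate is the multiplicity of [g]. In a kernel vector it must vanish:
    otherwise it is invertible modulo [p], which would put [g] in the range of [f]. *)
Lemma extend_additive m (f : {additive 'rV['Z_p]_m -> V}) (g : V) :
  injective f -> g *+ p = 0 -> ~ range f g ->
  exists2 h : {additive 'rV['Z_p]_m.+1 -> V}, injective h &
    forall v, exists w (k : nat), h v = f w + g *+ k.
Proof.
move=> fI gp fg; pose tl (v : 'rV['Z_p]_m.+1) := \row_j v 0 (lift ord0 j).
pose h v := f (tl v) + g *+ (v 0 ord0 : nat).
have tlD : {morph tl : v w / v + w}.
  by move=> v w; apply/rowP => j; rewrite !mxE.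
have h0 : h 0 = 0.
  rewrite /h mxE mulr0n addr0 -[RHS](raddf0 f); congr (f _).
  by apply/rowP => j; rewrite !mxE.
have hD : {morph h : v w / v + w}.
  move=> v w; rewrite /h tlD raddfD mxE.
  by rewrite [g *+ nat_of_ord (_ + _)]Zp_mulrn // mulrnDr addrACA.
pose hA : {additive 'rV['Z_p]_m.+1 -> V} :=
  HB.pack h (GRing.isNmodMorphism.Build _ _ h (h0, hD)).
exists hA; last by move=> v; exists (tl v), (v 0 ord0 : nat).
apply: raddf_inj => v /= hv.
have v0 : v 0 ord0 = 0.
  apply: contrapT => /eqP vn0; apply: fg.
  have uv : v 0 ord0 \is a GRing.unit.
    rewrite -[v 0 ord0]natr_Zp unitZpE ?prime_gt1 // prime_coprime //.
    rewrite gtnNdvd // ?lt0n //.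
    by have := ltn_ord (v 0 ord0); rewrite {2}Zp_cast ?prime_gt1.
  exists (- tl v *+ ((v 0 ord0)^-1 : 'Z_p)) => //.
  rewrite raddfMn raddfN /=.
  have -> : - f (tl v) = g *+ (v 0 ord0 : nat).
    by apply/eqP; rewrite eq_sym -subr_eq0 opprK addrC; apply/eqP.
  rewrite -mulrnA -Zp_mulrn //; have := mulrV uv => /(congr1 val) /= ->.
  by rewrite mulr1n.
apply/rowP => j; case: (unliftP ord0 j) => [i|] ->; last by rewrite v0 mxE.
move: hv; rewrite /h v0 mulr0n addr0 -[X in _ = X](raddf0 f) => /fI /rowP/(_ i).
by rewrite !mxE.
Qed.

(** Take the largest [m] for which [(Z/p)^m] embeds in [S]; it exists because [m < p ^ m <= n]. An
    element of [S] outside the range would allow one more coordinate. Stated for any [zmodType],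
    this serves both for [G] and for [D_G]. *)
Lemma elementary_abelian (S : set V) n : S #= `I_n -> S 0 ->
  (forall x y, S x -> S y -> S (x - y)) -> (forall x, S x -> x *+ p = 0) ->
  exists m, n = (p ^ m)%N /\
    exists f : {additive 'rV['Z_p]_m -> V}, injective f /\ range f = S.
Proof.
move=> Sn S0 SB Sp.
pose P m := `[< exists f : {additive 'rV['Z_p]_m -> V},
  injective f /\ range f `<=` S >].
have card_rV m : [set: 'rV['Z_p]_m] #= `I_(p ^ m)%N.
  have -> : (p ^ m)%N = #|{: 'rV['Z_p]_m}|.
    by rewrite card_mx card_ord Zp_cast ?prime_gt1 ?mul1n.
  exact: card_finType.
have card_ran m (f : {additive 'rV['Z_p]_m -> V}) : injective f ->
    range f #= `I_(p ^ m)%N.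
  by move=> fI; apply: card_inj_image (card_rV m) => x y _ _; apply: fI.
have P0 : exists m, P m.
  exists 0%N; apply/asboolP.
  exists (\0 : {additive 'rV['Z_p]_0 -> V}); split.
    by move=> x y _; rewrite [x]thinmx0 [y]thinmx0.
  by move=> _ [v _ <-].
have Pn m : P m -> (m <= n)%N.
  move=> /asboolP[f [fI fS]]; apply: leq_trans (ltnW (ltn_expl _ (prime_gt1 p_pr))) _.
  have := subset_card_le fS.
  by rewrite (card_le_eql (card_ran _ f fI)) (card_le_eqr Sn) card_le_II.
have [m /asboolP[f [fI fS]] m_max] := ex_maxnP P0 Pn.
have fE : range f = S.
  apply/seteqP; split=> // g Sg; apply: contrapT => fg.
  have [h hI hf] := extend_additive fI (Sp _ Sg) fg.
  have : P m.+1.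
    apply/asboolP; exists h; split=> // _ [v _ <-]; have [w [k ->]] := hf v.
    have Sfw : S (f w) by apply: fS; exists w.
    rewrite -[g *+ k]opprK; apply: (SB) => //; rewrite -sub0r; apply: (SB) => //.
    exact: (zmod_closed_mulrn _ S0 SB Sg).
  by move/m_max; rewrite ltnn.
exists m; split; last by exists f.
apply/card_eq_II; apply: card_eq_trans (card_ran _ f fI).
by rewrite fE card_eq_sym.
Qed.

End ElementaryAbelian.

(** * Linear algebra over a skew field *)

Section RightModule.
Variable D : unitRingType.

Lemma rscale_mulmx m (v : 'cV[D]_m) a : rscale v a = v *m a%:M.
Proof. by apply/colP => i; rewrite !mxE big_ord1 !mxE eqxx mulr1n. Qed.

Lemma mulmx_rscale m n (A : 'M[D]_(m, n)) v a :
  A *m rscale v a = rscale (A *m v) a.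
Proof. by rewrite !rscale_mulmx mulmxA. Qed.

Lemma rscaleDl m (u v : 'cV[D]_m) a : rscale (u + v) a = rscale u a + rscale v a.
Proof. by rewrite !rscale_mulmx mulmxDl. Qed.

Lemma rscaleNl m (u : 'cV[D]_m) a : rscale (- u) a = - rscale u a.
Proof. by rewrite !rscale_mulmx mulNmx. Qed.

Lemma rscaleDr m (u : 'cV[D]_m) a b : rscale u (a + b) = rscale u a + rscale u b.
Proof. by apply/colP => i; rewrite !mxE mulrDr. Qed.

Lemma rscaleNr m (u : 'cV[D]_m) a : rscale u (- a) = - rscale u a.
Proof. by apply/colP => i; rewrite !mxE mulrN. Qed.

Lemma rscaleA m (u : 'cV[D]_m) a b : rscale (rscale u a) b = rscale u (a * b).
Proof. by apply/colP => i; rewrite !mxE mulrA. Qed.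

Lemma rscale1 m (u : 'cV[D]_m) : rscale u 1 = u.
Proof. by apply/colP => i; rewrite !mxE mulr1. Qed.

Lemma rscale0 m (u : 'cV[D]_m) : rscale u 0 = 0.
Proof. by apply/colP => i; rewrite !mxE mulr0. Qed.

Lemma rscale0l m a : rscale (0 : 'cV[D]_m) a = 0.
Proof. by apply/colP => i; rewrite !mxE mul0r. Qed.

Lemma rscaleMn m (u : 'cV[D]_m) n : rscale u n%:R = u *+ n.
Proof. by apply/colP => i; rewrite !mxE mulmxnE !mulr_natr. Qed.

Definition ev m (f : 'rV[D]_m) (v : 'cV[D]_m) : D := (f *m v) 0 0.

Lemma ev_rscale m (f : 'rV[D]_m) v a : ev f (rscale v a) = ev f v * a.
Proof. by rewrite /ev mulmx_rscale mxE. Qed.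

Lemma evD m (f : 'rV[D]_m) u v : ev f (u + v) = ev f u + ev f v.
Proof. by rewrite /ev mulmxDr mxE. Qed.

Lemma evN m (f : 'rV[D]_m) u : ev f (- u) = - ev f u.
Proof. by rewrite /ev mulmxN mxE. Qed.

Lemma ev0 m (f : 'rV[D]_m) : ev f 0 = 0.
Proof. by rewrite /ev mulmx0 mxE. Qed.

Lemma evDl m (f g : 'rV[D]_m) u : ev (f + g) u = ev f u + ev g u.
Proof. by rewrite /ev mulmxDl mxE. Qed.

Lemma evNl m (f : 'rV[D]_m) u : ev (- f) u = - ev f u.
Proof. by rewrite /ev mulNmx mxE. Qed.

Lemma evZl m (f : 'rV[D]_m) a u : ev (a *: f) u = a * ev f u.
Proof. by rewrite /ev -scalemxAl mxE. Qed.

Lemma ev_mulmx m n (f : 'rV[D]_m) (A : 'M[D]_(m, n)) u :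
  ev f (A *m u) = ev (f *m A) u.
Proof. by rewrite /ev mulmxA. Qed.

Lemma ev_eq0 m (f : 'rV[D]_m) u : ev f u = 0 -> f *m u = 0.
Proof.
by move=> fu; apply/matrixP => i j; rewrite !ord1 [RHS]mxE.
Qed.

Lemma ev_delta m (f : 'rV[D]_m) i : ev f (delta_mx i 0) = f 0 i.
Proof.
rewrite /ev mxE (bigD1 i) //= !mxE !eqxx mulr1 big1 ?addr0 // => j ji.
by rewrite !mxE (negPf ji) mulr0.
Qed.

Lemma ev_all0 m (f : 'rV[D]_m) : (forall u, ev f u = 0) -> f = 0.
Proof. by move=> f0; apply/rowP => i; rewrite -ev_delta f0 mxE. Qed.

Lemma mulmx_columns m n p (A : 'M[D]_(m, n)) (B : 'M[D]_(m, p)) :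
  (forall j, colspan A (col j B)) -> exists C, A *m C = B.
Proof.
move=> AB; have /choice[c cE] : forall j, exists c, A *m c = col j B.
  by move=> j; have [c _] := AB j; exists c.
exists (\matrix_(i, j) c j i 0); apply/matrixP => i j.
have /colP/(_ i) := cE j; rewrite !mxE => <-.
by apply: eq_bigr => k _; rewrite !mxE.
Qed.

End RightModule.

Section SkewLinearAlgebra.
Variable D : unitRingType.
Hypothesis hD : GRing.field_axiom D.

(** Solve for a coordinate [i0] at which [f] does not vanish; the remaining coordinates are free
    parameters. *)
Lemma ker_form n (f : 'rV[D]_n.+1) : f != 0 ->
  exists2 A : 'M[D]_(n.+1, n), col_indep A & colspan A = [set v | ev f v = 0].
Proof.
case/rV0Pn => i0 fi0; have uf := hD fi0.
pose A : 'M[D]_(n.+1, n) := \matrix_(i, j)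
  if unlift i0 i is Some j' then (j' == j)%:R else - (f 0 i0)^-1 * f 0 (lift i0 j).
have Al c j : (A *m c) (lift i0 j) 0 = c j 0.
  rewrite mxE (bigD1 j) //= !mxE liftK eqxx mul1r big1 ?addr0 // => k kj.
  by rewrite !mxE liftK eq_sym (negPf kj) mul0r.
have A0 c : (A *m c) i0 0 = - (f 0 i0)^-1 * \sum_j f 0 (lift i0 j) * c j 0.
  rewrite mxE mulr_sumr; apply: eq_bigr => j _.
  by rewrite !mxE unlift_none mulrA.
have evE v : ev f v = f 0 i0 * v i0 0 + \sum_j f 0 (lift i0 j) * v (lift i0 j) 0.
  by rewrite /ev mxE (bigD1_ord i0).
exists A => [c Ac|].
  by apply/colP => j; rewrite -Al Ac !mxE.
apply/seteqP; split=> [_ [c _ <-]|v fv] /=.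
  rewrite evE A0 mulNr mulrN mulVKr // addrC -sumrB big1 // => j _.
  by rewrite Al subrr.
exists (\col_j v (lift i0 j) 0) => //; apply/colP => i.
case: (unliftP i0 i) => [j|] ->; first by rewrite Al mxE.
rewrite A0 mulNr; apply: (mulrI uf); rewrite mulrN mulVKr //.
move: fv; rewrite /= evE => /eqP; rewrite addr_eq0 => /eqP ->.
by congr (- _); apply: eq_bigr => j _; rewrite mxE.
Qed.

(** Induction on the number of equations: the kernel of the first row is parametrised by one unknown
    fewer, and the other rows are restricted to it. *)
Lemma col_dependent n m (A : 'M[D]_(n, m)) : (n < m)%N ->
  exists2 c : 'cV[D]_m, c != 0 & A *m c = 0.
Proof.
elim: n m A => [|n IHn] [//|m] A nm.
  by exists (const_mx 1); [apply/cV0Pn; exists ord0; rewrite mxE oner_neq0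
    |rewrite [LHS]flatmx0].
have splitE (c : 'cV_m.+1) : row ord0 A *m c = 0 -> row' ord0 A *m c = 0 -> A *m c = 0.
  move=> c0 c1; apply/colP => i; rewrite [RHS]mxE.
  case: (unliftP ord0 i) => [j|] ->.
    transitivity ((row' ord0 A *m c) j 0); last by rewrite c1 mxE.
    by rewrite !mxE; apply: eq_bigr => k _; rewrite !mxE.
  transitivity ((row ord0 A *m c) 0 0); last by rewrite c0 mxE.
  by rewrite !mxE; apply: eq_bigr => k _; rewrite !mxE.
have [f0|f0] := eqVneq (row ord0 A) 0.
  have [c c0 Ac] := IHn _ (row' ord0 A) (ltnW nm).
  by exists c => //; apply: splitE => //; rewrite f0 mul0mx.
have [K Ki KE] := ker_form f0.
have [c c0 Ac] := IHn _ (row' ord0 A *m K) nm.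
exists (K *m c); first by apply: contra_neq c0 => /Ki.
apply: splitE; last by rewrite mulmxA.
by apply: ev_eq0; have : colspan K (K *m c) by [exists c]; rewrite KE.
Qed.

End SkewLinearAlgebra.

(** Over a noncommutative ring, transposition reverses products only when it passes to the converse
    ring. A left dependence of rows over [D] is a right dependence of columns over [D^c]. *)
Lemma row_dependent (D : unitRingType) (hD : GRing.field_axiom D) n m
    (A : 'M[D]_(m, n)) : (n < m)%N -> exists2 f : 'rV[D]_m, f != 0 & f *m A = 0.
Proof.
move=> nm.
have hDc : GRing.field_axiom D^c by move=> x /hD.
have [c c0 Ac] := col_dependent hDc (A^T : 'M[D^c]_(n, m)) nm.
exists (c^T : 'rV[D]_m); first by apply: contra_neq c0 => /(congr1 trmx); rewrite trmxK trmx0.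
by apply: trmx_inj; rewrite trmx_mul_rev trmxK trmx0.
Qed.

Section SkewSubspaces.
Variable D : unitRingType.
Hypothesis hD : GRing.field_axiom D.

(** The [n + 1] columns of [C] and [w] are dependent, and [w] has a nonzero coefficient because the
    columns of [C] are independent. *)
Lemma indep_square_surj n (C : 'M[D]_n) : col_indep C ->
  forall w : 'cV[D]_n, exists c, C *m c = w.
Proof.
move=> Ci w.
have nn : (n < n + 1)%N by rewrite addn1.
have [c c0] := col_dependent hD (row_mx C w) nn.
rewrite -[c]vsubmxK mul_row_col.
set u := usubmx c; set b := dsubmx c => Cw.
have b0 : b 0 0 != 0.
  apply: contra_neq c0 => b0.
  have bE : b = 0 by apply/matrixP => i j; rewrite !ord1 b0 mxE.
  move: Cw; rewrite bE mulmx0 addr0 => /Ci uE.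
  by rewrite -[c]vsubmxK -/u -/b uE bE col_mx0.
exists (- rscale u (b 0 0)^-1).
have wb : w *m b = rscale w (b 0 0).
  by rewrite rscale_mulmx; congr (_ *m _); apply/matrixP => i j; rewrite !ord1 [RHS]mxE.
rewrite mulmxN mulmx_rscale; move/eqP: Cw; rewrite addr_eq0 => /eqP ->.
by rewrite rscaleNl opprK wb rscaleA mulrV ?hD // rscale1.
Qed.

Lemma colspan_colE n e (A : 'M[D]_(n, e)) j : colspan A (col j A).
Proof. by exists (delta_mx j 0) => //; rewrite colE. Qed.

(** Inclusion gives [A = A' *m C] with [C] square; independence passes from [A] to [C], which is
    therefore onto. *)
Lemma colspan_factor n e (A A' : 'M[D]_(n, e)) :
  col_indep A -> colspan A `<=` colspan A' -> colspan A = colspan A'.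
Proof.
move=> Ai AA'; have [C CE] : exists C, A' *m C = A.
  by apply: mulmx_columns => j; apply: AA'; apply: colspan_colE.
have Ci : col_indep C by move=> c Cc; apply: Ai; rewrite -CE -mulmxA Cc mulmx0.
apply/seteqP; split=> // _ [c' _ <-].
by have [c <-] := indep_square_surj Ci c'; exists c => //; rewrite -CE mulmxA.
Qed.

Lemma subspace_sub_eq n e (U U' : set 'cV[D]_n) :
  subspace e U -> subspace e U' -> U `<=` U' -> U = U'.
Proof. by move=> [A Ai ->] [A' _ ->]; apply: colspan_factor. Qed.

Lemma hyperplane_form n (U : set 'cV[D]_n.+1) : subspace n U ->
  exists2 f : 'rV[D]_n.+1, f != 0 & U = [set v | ev f v = 0].
Proof.
move=> sU; have [A _ UE] := sU.
have [f f0 fA] := row_dependent hD A (ltnSn n).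
exists f => //; have [K Ki KE] := ker_form hD f0.
apply: (subspace_sub_eq sU); first by rewrite -KE; exists K.
by rewrite UE => _ [c _ <-] /=; rewrite ev_mulmx fA /ev mul0mx mxE.
Qed.

(* Restricting the second form to a basis of the kernel of the first. *)
Lemma ker_two_forms n (f g : 'rV[D]_n.+2) : f != 0 ->
  (exists2 v, ev f v = 0 & ev g v != 0) ->
  exists2 A : 'M[D]_(n.+2, n), col_indep A &
    colspan A = [set v | ev f v = 0 /\ ev g v = 0].
Proof.
move=> f0 [v fv gv]; have [K Ki KE] := ker_form hD f0.
have gK : g *m K != 0.
  have [c _ vE] : colspan K v by rewrite KE.
  by apply: contra_neq gv => gK; rewrite -vE ev_mulmx gK /ev mul0mx mxE.
have [L Li LE] := ker_form hD gK.
exists (K *m L) => [c|]; first by rewrite -mulmxA => /Ki /Li.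
apply/seteqP; split=> [_ [c _ <-]|u [fu gu]] /=.
  split; first by have : colspan K (K *m (L *m c)) by [exists (L *m c)]; rewrite KE mulmxA.
  have : colspan L (L *m c) by exists c.
  by rewrite LE /= -ev_mulmx mulmxA.
have [c _ uE] : colspan K u by rewrite KE.
have [c' _ cE] : colspan L c by rewrite LE /= -ev_mulmx uE.
by exists c' => //; rewrite -mulmxA cE.
Qed.

Lemma indep_is_basis n (M : 'M[D]_n) : col_indep M -> is_basis M.
Proof.
move=> Mi; split=> //; apply/seteqP; split=> // w _.
by have [c <-] := indep_square_surj Mi w; exists c.
Qed.

End SkewSubspaces.

(** * Points, lines and hyperplanes *)

Section Points.
Variable D : unitRingType.
Hypothesis hD : GRing.field_axiom D.

Lemma colspan_cV n (v : 'cV[D]_n) : colspan v = range (rscale v).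
Proof.
apply/seteqP; split=> [_ [c _ <-]|_ [a _ <-]].
  exists (c 0 0) => //; rewrite rscale_mulmx; congr (_ *m _).
  by apply/matrixP => i j; rewrite !ord1 [LHS]mxE.
by exists a%:M => //; rewrite rscale_mulmx.
Qed.

Lemma rscale_eq0 n (v : 'cV[D]_n) a : v != 0 -> rscale v a = 0 -> a = 0.
Proof.
case/cV0Pn => i vi /colP/(_ i); rewrite !mxE => /(skew_mulf_eq0 hD)[/eqP|//].
by rewrite (negPf vi).
Qed.

Lemma rscaleI n (v : 'cV[D]_n) : v != 0 -> injective (rscale v).
Proof.
move=> v0 a b ab; apply/eqP; rewrite -subr_eq0; apply/eqP.
by apply: (rscale_eq0 v0); rewrite rscaleDr rscaleNr ab subrr.
Qed.

Lemma rscaleK n (v : 'cV[D]_n) a : a != 0 -> rscale (rscale v a) a^-1 = v.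
Proof. by move=> /hD ua; rewrite rscaleA mulrV // rscale1. Qed.

Lemma rscaleVK n (v : 'cV[D]_n) a : a != 0 -> rscale (rscale v a^-1) a = v.
Proof. by move=> /hD ua; rewrite rscaleA mulVr // rscale1. Qed.

Lemma rscale_neq0 n (v : 'cV[D]_n) a : v != 0 -> a != 0 -> rscale v a != 0.
Proof. by move=> v0; apply: contra_neq => /(rscale_eq0 v0). Qed.

Lemma col_indep_cV n (v : 'cV[D]_n) : col_indep v <-> v != 0.
Proof.
split=> [vi|v0 c].
  apply/eqP => v0; have vc : v *m (const_mx 1 : 'cV_1) = 0 by rewrite v0 mul0mx.
  have := vi _ vc.
  by move=> /matrixP/(_ 0 0); rewrite !mxE => /eqP; apply/negP/oner_neq0.
have -> : c = (c 0 0)%:M by apply/matrixP => i j; rewrite !ord1 [RHS]mxE.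
by rewrite -rscale_mulmx => /(rscale_eq0 v0) ->; apply/matrixP => i j; rewrite !ord1 !mxE.
Qed.

Lemma rscale_eq0r n (v : 'cV[D]_n) a : a != 0 -> rscale v a = 0 -> v = 0.
Proof. by move=> a0 va; rewrite -(rscaleK v a0) va rscale0l. Qed.

Lemma range_rscale n (v : 'cV[D]_n) a : a != 0 ->
  range (rscale (rscale v a)) = range (rscale v).
Proof.
move=> a0; apply/seteqP; split=> _ [b _ <-].
  by exists (a * b) => //; rewrite rscaleA.
by exists (a^-1 * b) => //; rewrite -rscaleA rscaleK.
Qed.

Section Dim.
Variable d : nat.
Local Notation pt := (ppoint D d).

Lemma ppoint_eq (p q : pt) : vecs p = vecs q -> p = q.
Proof.
case: p q => [U hU] [U' hU'] /= UU; case: _ / UU in hU' *.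
by congr PPoint; apply: Prop_irrelevance.
Qed.

Lemma ppoint_vec (p : pt) : exists v : 'cV[D]_d.+1, v != 0 /\ vecs p = range (rscale v).
Proof.
case: p => U [A Ai UE] /=; exists A; split; first exact/col_indep_cV.
by rewrite UE colspan_cV.
Qed.

Definition pvec (p : pt) : 'cV[D]_d.+1 := projT1 (cid (ppoint_vec p)).

Lemma pvec_neq0 p : pvec p != 0.
Proof. by rewrite /pvec; case: cid => v []. Qed.

Lemma vecsE p : vecs p = range (rscale (pvec p)).
Proof. by rewrite /pvec; case: cid => v []. Qed.

Lemma pvec_in p : vecs p (pvec p).
Proof. by rewrite vecsE; exists 1; rewrite ?rscale1. Qed.

Lemma span_point (v : 'cV[D]_d.+1) : v != 0 -> exists p : pt, vecs p = range (rscale v).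
Proof.
move=> v0; have sv : subspace 1 (range (rscale v)).
  by exists v; [exact/col_indep_cV|rewrite colspan_cV].
by exists (PPoint sv).
Qed.

Lemma vecs_span (p : pt) v : v != 0 ->
  vecs p = range (rscale v) <-> exists2 a, a != 0 & pvec p = rscale v a.
Proof.
move=> v0; split=> [pE|[a a0 pE]].
  have := pvec_in p; rewrite pE => -[a _ aE]; exists a => //.
  by apply: contra_eq_neq aE => ->; rewrite rscale0 eq_sym pvec_neq0.
by rewrite vecsE pE range_rscale.
Qed.

Lemma pvec_inj p q a : pvec p = rscale (pvec q) a -> p = q.
Proof.
move=> pq; apply: ppoint_eq; rewrite (vecsE q); apply/vecs_span; first exact: pvec_neq0.
exists a => //; apply: contra_eq_neq pq => ->; by rewrite rscale0 pvec_neq0.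
Qed.

Definition hpl (f : 'rV[D]_d.+1) : set pt := [set p | ev f (pvec p) = 0].

Lemma vecs_sub_ker (f : 'rV[D]_d.+1) p :
  vecs p `<=` [set v | ev f v = 0] <-> hpl f p.
Proof.
split=> [/(_ _ (pvec_in p))//|fp v].
by rewrite vecsE => -[a _ <-] /=; rewrite ev_rscale fp mul0r.
Qed.

Definition joinline (x y : pt) : set pt := [set z | exists a b,
  pvec z = rscale (pvec x) a + rscale (pvec y) b].

Lemma indep_pair x y a b : x <> y ->
  rscale (pvec x) a + rscale (pvec y) b = 0 -> a = 0 /\ b = 0.
Proof.
move=> xy /eqP ab; have b0 : b = 0.
  apply: contrapT => /eqP b0; apply: xy.
  symmetry; apply: (@pvec_inj _ _ (- a * b^-1)).
  rewrite -rscaleA rscaleNr; move: ab; rewrite addrC addr_eq0 => /eqP <-.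
  by rewrite rscaleK.
split=> //; move: ab; rewrite b0 rscale0 addr0 => /eqP.
exact/rscale_eq0/pvec_neq0.
Qed.

(** The representatives of [x] and [y] span a two-dimensional subspace of the subspace of [L]; equal
    dimensions turn inclusion into equality. *)
Lemma line_joinE L x y : is_line L -> L x -> L y -> x <> y -> L = joinline x y.
Proof.
move=> [U sU ->] /= Ux Uy xy.
pose W : 'M[D]_(d.+1, 1 + 1) := row_mx (pvec x) (pvec y).
have WE (c : 'cV[D]_(1 + 1)) : W *m c = rscale (pvec x) (usubmx c 0 0) +
    rscale (pvec y) (dsubmx c 0 0).
  rewrite -[c in LHS]vsubmxK mul_row_col !rscale_mulmx.
  by congr (_ + _); congr (_ *m _); apply/matrixP => i j; rewrite !ord1 [RHS]mxE.
have WcE a b : W *m (col_mx a%:M b%:M) = rscale (pvec x) a + rscale (pvec y) b.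
  by rewrite mul_row_col -!rscale_mulmx.
have UE : colspan W = U.
  apply: (subspace_sub_eq hD _ sU).
    exists W => // c; rewrite WE => /(indep_pair xy)[c0 c1].
    have usub0 : usubmx (c : 'cV_(1 + 1)) = 0.
      by apply/matrixP => i j; rewrite !ord1 c0 [RHS]mxE.
    have dsub0 : dsubmx (c : 'cV_(1 + 1)) = 0.
      by apply/matrixP => i j; rewrite !ord1 c1 [RHS]mxE.
    by rewrite -(vsubmxK (c : 'cV_(1 + 1))) usub0 dsub0 col_mx0.
  move=> _ [c _ <-]; case: sU Ux Uy => A _ -> Ux Uy.
  have [cx _ cxE] := Ux _ (pvec_in x); have [cy _ cyE] := Uy _ (pvec_in y).
  rewrite WE -cxE -cyE -!mulmx_rscale -mulmxDr.
  by exists (rscale cx (usubmx c 0 0) + rscale cy (dsubmx c 0 0)).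
apply/seteqP; split=> [z /(_ _ (pvec_in z))|z [a [b zE]] v] /=.
  by rewrite -UE => -[c _ cE]; exists (usubmx c 0 0), (dsubmx c 0 0); rewrite -WE.
rewrite vecsE -UE => -[c _ <-]; exists (rscale (col_mx a%:M b%:M) c) => //.
by rewrite mulmx_rscale WcE zE.
Qed.

End Dim.

Section Hyperplanes.
Variable d : nat.
Local Notation pt := (ppoint D d.+1).

Lemma is_hyperplaneP (F : set pt) :
  is_hyperplane F <-> exists2 f : 'rV[D]_d.+2, f != 0 & F = hpl f.
Proof.
split=> [[U sU ->]|[f f0 ->]].
  have [f f0 ->] := hyperplane_form hD sU; exists f => //.
  by apply/seteqP; split=> p /vecs_sub_ker.
have [A Ai AE] := ker_form hD f0; exists [set v | ev f v = 0].
  by exists A.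
by apply/seteqP; split=> p /vecs_sub_ker.
Qed.

End Hyperplanes.

End Points.

(** * Transversal designs *)

Lemma card_index_range1 k : index_range 1 k #= `I_k.
Proof.
have -> : index_range 1 k = S @` `I_k.
  apply/seteqP; split=> [[|i] //= ik|_ [i /= ik <-]]; first by exists i.
  by rewrite /index_range /=.
by apply: card_inj_image => // i j _ _ [].
Qed.

Section TDFacts.
Variables (T : Type) (k n : nat) (V : set T) (P B : set (set T)).
Variable W : nat -> set T.
Hypothesis TD : is_TD k n V P B.
Hypothesis PE : P = [set W i | i in index_range 1 k].

Lemma TD_part i : index_range 1 k i -> P (W i).
Proof. by move=> ik; rewrite PE; exists i. Qed.

Lemma TD_part_card i : index_range 1 k i -> W i #= `I_n.
Proof. by move=> /TD_part; case: TD => _ _ [_ _ +] _ _; apply. Qed.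

Lemma TD_part_sub i : index_range 1 k i -> W i `<=` V.
Proof.
move=> /TD_part Pi x Wx; case: TD => _ _ [[<- _ _] _ _] _ _.
by exists (W i).
Qed.

Lemma TD_part_cover x : V x -> exists2 i, index_range 1 k i & W i x.
Proof.
case: TD => _ _ [[<- _ _] _ _] _ _ [A /=].
by rewrite PE => -[i ik <-] Wx; exists i.
Qed.

(** A partition separates parts only as sets. Distinct indices give distinct parts because the [k]
    indices map onto a family of exactly [k] parts. *)
Lemma TD_part_disj i j x : index_range 1 k i -> index_range 1 k j ->
  W i x -> W j x -> i = j.
Proof.
move=> ik jk Wi Wj; case: TD => _ _ [[_ triv _] Pk _] _ _.
have W_inj : set_inj (index_range 1 k) W.
  by apply: card_surj_inj (card_index_range1 k) _; rewrite -PE.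
apply: W_inj; rewrite ?inE //; apply: triv; rewrite ?inE; try exact: TD_part.
by exists x.
Qed.

Lemma TD_join i j x y : index_range 1 k i -> index_range 1 k j -> i <> j ->
  W i x -> W j y -> exists! b, B b /\ b x /\ b y.
Proof.
move=> ik jk ij Wx Wy; case: TD => _ _ _ _ /(_ x y).
have [Vx Vy] := (TD_part_sub ik Wx, TD_part_sub jk Wy).
case=> //.
- by move=> xy; apply: ij; apply: (TD_part_disj ik jk Wx); rewrite xy.
- case=> -[A [[]]]; rewrite PE => -[l lk <-] [Wlx Wly] _ _; case: ij.
  by rewrite (TD_part_disj ik lk Wx Wlx) (TD_part_disj jk lk Wy Wly).
- by case.
Qed.

Lemma TD_block_part b i x y : B b -> index_range 1 k i ->
  b x -> b y -> W i x -> W i y -> x = y.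
Proof.
move=> Bb ik bx by_ Wx Wy; apply: contrapT => xy.
have [Vx Vy] := (TD_part_sub ik Wx, TD_part_sub ik Wy).
case: TD => _ _ _ _ /(_ x y Vx Vy xy)[[_]|[]]; case; first by exists b.
by exists (W i); split; [exact: TD_part|].
Qed.

(** Sending a point of the block to the index of its part is injective, hence onto, as there are [k]
    points and [k] indices. *)
Lemma TD_block_meet b i : B b -> index_range 1 k i -> exists x, b x /\ W i x.
Proof.
move=> Bb ik; case: (TD) => _ _ _ /(_ b Bb)[bV bk] _.
have /choice[c cP] : forall x, exists i, b x -> index_range 1 k i /\ W i x.
  move=> x; have [bx|nbx] := pselect (b x); last by exists 0%N.
  by have [j jk Wj] := TD_part_cover (bV x bx); exists j.
have c_inj : set_inj b c.
  move=> x y /set_mem bx /set_mem by_ cxy.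
  have [ck Wx] := cP x bx; have [_ Wy] := cP y by_.
  by apply: (TD_block_part Bb ck) => //; rewrite cxy.
have : c @` b = index_range 1 k.
  apply: card_sub_eq (card_inj_image c_inj bk) (card_index_range1 k).
  by move=> _ [x bx <-]; have [] := cP x bx.
by move=> /seteqP[_ /(_ i ik)[x bx <-]]; exists x; split=> //; have [] := cP x bx.
Qed.

End TDFacts.

Lemma card_enum (T : Type) (x0 : T) (A : set T) n :
  A #= `I_n -> exists e : nat -> T, set_bij `I_n A e.
Proof.
pose U : pointedType := HB.pack {classic T} (isPointed.Build {classic T} x0).
move=> An; have : `I_n #= (A : set U) by rewrite card_eq_sym.
by move=> /card_set_bijP.
Qed.

(** * Assembling a transversal design from parts and blocks *)

Section BuildTD.
Variables (T : Type) (k n : nat) (B : set (set T)) (W : nat -> set T).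
Hypotheses (k_ge3 : (3 <= k)%N) (n_ge3 : (3 <= n)%N).
Hypothesis W_card : forall i, index_range 1 k i -> W i #= `I_n.
Hypothesis W_disj : forall i j x, index_range 1 k i -> index_range 1 k j ->
  W i x -> W j x -> i = j.
Hypothesis B_sub : forall b, B b -> b `<=` \bigcup_(i in index_range 1 k) W i.
Hypothesis B_meet : forall b i, B b -> index_range 1 k i ->
  exists x, b `&` W i = [set x].
Hypothesis B_join : forall i j x y, index_range 1 k i -> index_range 1 k j -> i <> j ->
  W i x -> W j y -> exists! b, B b /\ b x /\ b y.

Lemma W_neq0 i : index_range 1 k i -> W i !=set0.
Proof.
move=> ik; apply/set0P/negP => /eqP W0; have := W_card ik.
rewrite W0 card_eq_sym (card_eq0 (A := `I_n)) => /eqP/seteqP[/(_ 0%N) + _].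
by apply; apply: leq_trans n_ge3.
Qed.

Lemma card_bigcup : \bigcup_(i in index_range 1 k) W i #= `I_(k * n).
Proof.
have n_gt0 : (0 < n)%N by apply: leq_trans n_ge3.
have /choice[e eP] : forall i, exists e : nat -> T,
    index_range 1 k i -> set_bij `I_n (W i) e.
  move=> i; have [ik|ik] := pselect (index_range 1 k i).
    have [x _] := W_neq0 ik.
    by have [e eb] := card_enum x (W_card ik); exists e.
  have [x _] : W 1%N !=set0 by apply: W_neq0; apply/andP; split=> //; apply: leq_trans k_ge3.
  by exists (fun=> x).
have range_div t : (t < k * n)%N -> index_range 1 k (t %/ n).+1.
  by move=> tk; apply/andP; split=> //; rewrite ltn_divLR.
(* The quotient of [t] by [n] selects the part, shifted by one since parts are numbered from 1; the
   remainder enumerates that part. *)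
have -> : \bigcup_(i in index_range 1 k) W i =
    (fun t => e (t %/ n).+1 (t %% n)%N) @` `I_(k * n).
  apply/seteqP; split=> [x [[|i] //= ik Wx]|_ [t /= tk <-]]; last first.
    exists (t %/ n).+1; first exact: range_div.
    by have [+ _ _] := eP _ (range_div _ tk); apply; rewrite /= ltn_pmod.
  have [_ _ es] := eP _ ik; have [l /= ln <-] := es _ Wx.
  exists (i * n + l)%N; last by rewrite divnMDl // divn_small // addn0 modnMDl modn_small.
  move: ik => /andP[_ ik]; apply: (@leq_trans (i.+1 * n)%N); last by rewrite leq_mul2r ik orbT.
  by rewrite mulSn addnC ltn_add2r.
apply: card_inj_image (card_eqxx _) => s t /set_mem /= sk /set_mem /= tk est.
have [e_fun e_inj _] := eP _ (range_div _ sk).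
have [f_fun _ _] := eP _ (range_div _ tk).
have st : (s %/ n).+1 = (t %/ n).+1.
  apply: (W_disj (range_div _ sk) (range_div _ tk) (x := e (s %/ n).+1 (s %% n)%N)).
    by apply: e_fun; rewrite /= ltn_pmod.
  by rewrite est; apply: f_fun; rewrite /= ltn_pmod.
move: est; rewrite -st => /e_inj; rewrite !inE /= !ltn_pmod // => /(_ erefl erefl) st'.
by rewrite (divn_eq s n) (divn_eq t n) st'; case: st => ->.
Qed.

Lemma W_inj : set_inj (index_range 1 k) W.
Proof.
move=> i j /set_mem ik /set_mem jk Wij; have [x Wx] := W_neq0 ik.
by apply: (W_disj ik jk Wx); rewrite -Wij.
Qed.

Lemma TD_of_parts : is_TD k n (\bigcup_(i in index_range 1 k) W i)
  [set W i | i in index_range 1 k] B.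
Proof.
split=> //; first exact: card_bigcup.
- split; last by move=> _ [i ik <-]; exact: W_card.
    split.
    + by rewrite /cover bigcup_image.
    + move=> _ _ [i ik <-] [j jk <-] [x [Wi Wj]] /=.
      by rewrite (W_disj ik jk Wi Wj).
    + by move=> _ [i ik <-]; exact: W_neq0.
  by apply: card_inj_image (card_index_range1 k); exact: W_inj.
- move=> b Bb; split; first exact: B_sub.
  have /choice[c cP] : forall i, exists x, index_range 1 k i -> b `&` W i = [set x].
    move=> i; have [ik|ik] := pselect (index_range 1 k i).
      by have [x bx] := B_meet Bb ik; exists x.
    have [x _] : W 1%N !=set0 by apply: W_neq0; apply/andP; split=> //; apply: leq_trans k_ge3.
    by exists x.
  have cW i : index_range 1 k i -> b (c i) /\ W i (c i).
    by move=> ik; have /seteqP[_ /(_ _ erefl)] := cP i ik.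
  have -> : b = c @` index_range 1 k.
    apply/seteqP; split=> [x bx|_ [i ik <-]]; last exact: (cW i ik).1.
    have [i ik Wx] := B_sub Bb bx; exists i => //.
    by have /seteqP[/(_ x (conj bx Wx)) -> _] := cP i ik.
  apply: card_inj_image (card_index_range1 k) => i j /set_mem ik /set_mem jk cij.
  by apply: (W_disj ik jk (cW i ik).2); rewrite cij; exact: (cW j jk).2.
- move=> x y [i ik Wx] [j jk Wy] xy; have [ij|ij] := pselect (i = j).
    rewrite -ij in Wy; left; split.
      exists (W i); split; first by split=> //; exists i.
      by move=> _ [[l lk <-] [Wlx _]]; rewrite (W_disj ik lk Wx Wlx).
    move=> [b [Bb [bx by_]]]; apply: xy.
    have [z /seteqP[bz _]] := B_meet Bb ik.
    by rewrite (bz x (conj bx Wx)) (bz y (conj by_ Wy)).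
  right; split; last exact: B_join Wx Wy.
  move=> [_ [[l lk <-] [Wlx Wly]]]; apply: ij.
  by rewrite (W_disj ik lk Wx Wlx) (W_disj jk lk Wy Wly).
Qed.

End BuildTD.

(** * Homogeneous coordinates *)

Section Frames.
Variable D : unitRingType.
Hypothesis hD : GRing.field_axiom D.
Variable m : nat.
Local Notation pt := (ppoint D m.+1).
Implicit Types (x : 'cV[D]_m) (y z : D).

Let hv x y z : 'cV[D]_m.+2 := @hvec D m.+1 x y z.

Definition idx_x (j : 'I_m) : 'I_m.+2 := widen_ord (leqnSn _) (widen_ord (leqnSn _) j).
Definition idx_y : 'I_m.+2 := widen_ord (leqnSn _) ord_max.
Definition idx_z : 'I_m.+2 := ord_max.

Variant idx_spec : 'I_m.+2 -> Prop :=
| IdxX j : idx_spec (idx_x j)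
| IdxY : idx_spec idx_y
| IdxZ : idx_spec idx_z.

Lemma idxP i : idx_spec i.
Proof.
have [im|] := ltnP i m.
  have -> : i = idx_x (Ordinal im) by apply: val_inj.
  by constructor.
rewrite leq_eqVlt => /orP[/eqP mi|mi].
  have -> : i = idx_y by apply: val_inj.
  by constructor.
have -> : i = idx_z.
  by apply: val_inj; apply/eqP; rewrite eqn_leq mi -ltnS ltn_ord.
by constructor.
Qed.

Lemma hvecX x y z j : hv x y z (idx_x j) 0 = x j 0.
Proof.
rewrite mxE /=; case: insubP => [j' _ jj|]; last by rewrite ltn_ord.
by congr (x _ _); apply: val_inj.
Qed.

Lemma hvecY x y z : hv x y z idx_y 0 = y.
Proof. by rewrite mxE /= insubF ?ltnn ?eqxx. Qed.

Lemma hvecZ x y z : hv x y z idx_z 0 = z.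
Proof.
rewrite mxE /= insubF; last by rewrite ltnNge leqnSn.
by rewrite gtn_eqF.
Qed.

Lemma hvecP x y z (v : 'cV[D]_m.+2) :
  (forall j, v (idx_x j) 0 = x j 0) -> v idx_y 0 = y -> v idx_z 0 = z -> v = hv x y z.
Proof.
by move=> vx vy vz; apply/colP => i; case: (idxP i) => [j||];
  rewrite ?hvecX ?hvecY ?hvecZ.
Qed.

Lemma hvec_ex (c : 'cV[D]_m.+2) : exists x y z, c = hv x y z.
Proof.
exists (\col_j c (idx_x j) 0), (c idx_y 0), (c idx_z 0).
by apply: hvecP => [j||] //; rewrite mxE.
Qed.

Lemma hvec_rscale x y z a : rscale (hv x y z) a = hv (rscale x a) (y * a) (z * a).
Proof. by apply: hvecP => [j||]; rewrite mxE ?hvecX ?hvecY ?hvecZ ?mxE. Qed.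

(** The matrix with the columns of [A], then [u], then [w]. Building each row with [hv] avoids casts
    between [m + 2] and [m.+2]. *)
Definition frame (A : 'M[D]_(m.+2, m)) (u w : 'cV[D]_m.+2) : 'M[D]_m.+2 :=
  \matrix_(i, j) hv (\col_k A i k) (u i 0) (w i 0) j 0.

Lemma big_idx (F : 'I_m.+2 -> D) :
  \sum_i F i = \sum_j F (idx_x j) + F idx_y + F idx_z.
Proof. by rewrite !big_ord_recr. Qed.

Lemma frame_hvec A u w x y z :
  frame A u w *m hv x y z = A *m x + rscale u y + rscale w z.
Proof.
apply/colP => i; rewrite !mxE big_idx.
rewrite [frame _ _ _ _ _]mxE [frame _ _ _ _ _]mxE !hvecY !hvecZ.
do 2 congr (_ + _); apply: eq_bigr => j _.
by rewrite [frame _ _ _ _ _]mxE !hvecX mxE.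
Qed.

(** The coordinate functions are the rows of the inverse of [M]. Spanning gives a right inverse [N];
    it is also a left inverse, since [M *m (N *m M - 1) = 0] and [M] is injective. *)
Lemma basis_coords (M : 'M[D]_m.+2) : is_basis M ->
  exists (X : 'M[D]_(m, m.+2)) (fy fz : 'rV[D]_m.+2),
    (forall x y z, [/\ X *m (M *m hv x y z) = x, ev fy (M *m hv x y z) = y
                     & ev fz (M *m hv x y z) = z]) /\
    (forall v, v = M *m hv (X *m v) (ev fy v) (ev fz v)).
Proof.
move=> [Mi MT].
have [N MN] : exists N, M *m N = 1%:M.
  by apply: mulmx_columns => j; rewrite MT.
have NM : N *m M = 1%:M.
  apply/matrixP => i j; apply/eqP; rewrite -subr_eq0; apply/eqP.
  have : M *m ((N *m M - 1%:M) *m (delta_mx j 0 : 'cV_m.+2)) = 0.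
    by rewrite mulmxA mulmxBr mulmxA MN mul1mx mulmx1 subrr mul0mx.
  by move/Mi/colP/(_ i); rewrite -colE !mxE.
exists (\matrix_(j, i) N (idx_x j) i), (row idx_y N), (row idx_z N).
have XE v : (\matrix_(j, i) N (idx_x j) i) *m v = \col_j (N *m v) (idx_x j) 0.
  by apply/colP => j; rewrite !mxE; apply: eq_bigr => k _; rewrite mxE.
have rE i v : ev (row i N) v = (N *m v) i 0 by rewrite /ev -row_mul mxE.
split=> [x y z|v].
  split; rewrite ?XE ?rE mulmxA NM mul1mx ?hvecY ?hvecZ //.
  by apply/colP => j; rewrite mxE hvecX.
rewrite XE !rE; have -> : hv (\col_j (N *m v) (idx_x j) 0) ((N *m v) idx_y 0)
    ((N *m v) idx_z 0) = N *m v.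
  by symmetry; apply: hvecP => [j||] //; rewrite [RHS]mxE.
by rewrite mulmxA MN mul1mx.
Qed.
Section Coordinates.
Variables (M : 'M[D]_m.+2) (X : 'M[D]_(m, m.+2)) (fy fz : 'rV[D]_m.+2).
Hypothesis Mcoord : forall x y z, [/\ X *m (M *m hv x y z) = x,
  ev fy (M *m hv x y z) = y & ev fz (M *m hv x y z) = z].
Hypothesis coordM : forall v, v = M *m hv (X *m v) (ev fy v) (ev fz v).
Lemma coord_neq0 x y z : [\/ x != 0, y != 0 | z != 0] -> M *m hv x y z != 0.
Proof.
have [Xh Yh Zh] := Mcoord x y z.
move=> xyz; apply/eqP => M0; rewrite M0 in Xh Yh Zh.
by case: xyz; rewrite -?Xh -?Yh -?Zh ?mulmx0 ?ev0 eqxx.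
Qed.
Lemma has_coordsP x y z (p : pt) : [\/ x != 0, y != 0 | z != 0] ->
  has_coords M x y z p <->
  exists2 a, a != 0 & [/\ X *m pvec hD p = rscale x a, ev fy (pvec hD p) = y * a
                        & ev fz (pvec hD p) = z * a].
Proof.
move=> /coord_neq0 M0; rewrite /has_coords colspan_cV.
have [Xh Yh Zh] := Mcoord x y z.
split=> [/(vecs_span hD p M0)[a a0 pE]|[a a0 [Xp Yp Zp]]].
  exists a => //; rewrite pE mulmx_rscale !ev_rscale.
  by split; [congr rscale|congr (_ * _)|congr (_ * _)].
apply/(vecs_span hD p M0); exists a => //.
by rewrite [LHS]coordM Xp Yp Zp -mulmx_rscale; congr (_ *m _); rewrite -hvec_rscale.
Qed.
Lemma has_coords_self (p : pt) :
  has_coords M (X *m pvec hD p) (ev fy (pvec hD p)) (ev fz (pvec hD p)) p.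
Proof.
rewrite /has_coords colspan_cV vecsE; congr (range (rscale _)).
by apply: funext => _; exact: coordM.
Qed.

Lemma has_coords_aff x y (p : pt) : has_coords M x y 1 p <->
  [/\ ev fz (pvec hD p) != 0, ev fy (pvec hD p) = y * ev fz (pvec hD p)
    & X *m pvec hD p = rscale x (ev fz (pvec hD p))].
Proof.
rewrite has_coordsP; last by constructor 3; rewrite oner_neq0.
split=> [[a a0 [-> ->]]|[z0 -> ->]]; first by rewrite mul1r => ->.
by exists (ev fz (pvec hD p)); rewrite ?mul1r.
Qed.
Lemma has_coords_inf x (p : pt) : has_coords M x 1 0 p <->
  [/\ ev fy (pvec hD p) != 0, ev fz (pvec hD p) = 0
    & X *m pvec hD p = rscale x (ev fy (pvec hD p))].
Proof.
rewrite has_coordsP; last by constructor 2; rewrite oner_neq0.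
split=> [[a a0 [-> ]]|[z0 -> ->]]; first by rewrite mul1r mul0r => -> ->.
by exists (ev fy (pvec hD p)); rewrite ?mul1r ?mul0r.
Qed.
Lemma coord_point x y z : [\/ x != 0, y != 0 | z != 0] ->
  exists p : pt, has_coords M x y z p.
Proof.
by move=> /coord_neq0/(span_point hD)[p pE]; exists p; rewrite /has_coords colspan_cV.
Qed.
Lemma locus_hpl (f : 'rV[D]_m.+2) (E : 'cV[D]_m -> D -> D -> Prop) :
  (forall x y z, E x y z <-> ev f (M *m hv x y z) = 0) ->
  @locus D m.+1 M E = hpl hD f.
Proof.
move=> Ef; apply/seteqP; split=> p /=.
  by move=> /(_ _ _ _ (has_coords_self p)) /Ef; rewrite /hpl /= -coordM.
move=> fp x y z; rewrite /has_coords colspan_cV => pE; apply/Ef.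
have [M0|M0] := eqVneq (M *m hv x y z) 0; first by rewrite M0 ev0.
have /(vecs_span hD p M0) [a a0 pvE] := pE.
move: fp; rewrite /hpl /= pvE ev_rscale => /(skew_mulf_eq0 hD)[//|/eqP].
by rewrite (negPf a0).
Qed.
Lemma locus_y : @locus D m.+1 M (fun _ y _ => y = 0) = hpl hD fy.
Proof. by apply: locus_hpl => x y z; have [_ -> _] := Mcoord x y z. Qed.
Lemma locus_z : @locus D m.+1 M (fun _ _ z => z = 0) = hpl hD fz.
Proof. by apply: locus_hpl => x y z; have [_ _ ->] := Mcoord x y z. Qed.
Lemma locus_yz : @locus D m.+1 M (fun _ y z => y = z) = hpl hD (fy - fz).
Proof.
apply: locus_hpl => x y z; have [_ Yh Zh] := Mcoord x y z.
rewrite evDl evNl Yh Zh; split=> [->|/eqP]; first by rewrite subrr.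
by rewrite subr_eq0 => /eqP.
Qed.
End Coordinates.
End Frames.

(** * Collinearity and the associated group *)

Section Collinear.
Variable D : unitRingType.
Hypothesis hD : GRing.field_axiom D.

Definition collin n (u v w : 'cV[D]_n) : Prop := exists a b c,
  rscale u a + rscale v b + rscale w c = 0 /\ [\/ a != 0, b != 0 | c != 0].

Lemma collin_perm n (u v w : 'cV[D]_n) : collin u v w -> collin v w u.
Proof.
move=> [a [b [c [E abc]]]]; exists b, c, a; split; last by case: abc; constructor.
by rewrite addrC addrA.
Qed.

Lemma collin_swap n (u v w : 'cV[D]_n) : collin u v w -> collin v u w.
Proof.
move=> [a [b [c [E abc]]]]; exists b, a, c; split; last by case: abc; constructor.
by rewrite [rscale v b + _]addrC.
Qed.

Lemma joinline_collin d (x y z : ppoint D d) : joinline hD x y z ->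
  collin (pvec hD x) (pvec hD y) (pvec hD z).
Proof.
move=> [a [b zE]]; exists a, b, (-1); rewrite rscaleNr rscale1 zE subrr; split=> //.
by constructor 3; rewrite oppr_eq0 oner_neq0.
Qed.

Variable m : nat.
Local Notation pt := (ppoint D m.+1).
Variables (M : 'M[D]_m.+2) (X : 'M[D]_(m, m.+2)) (fy fz : 'rV[D]_m.+2).
Hypothesis Mcoord : forall x y z, [/\ X *m (M *m @hvec D m.+1 x y z) = x,
  ev fy (M *m @hvec D m.+1 x y z) = y & ev fz (M *m @hvec D m.+1 x y z) = z].
Hypothesis coordM : forall v, v = M *m @hvec D m.+1 (X *m v) (ev fy v) (ev fz v).
Local Notation "''[' x , y , z ']' p" := (@has_coords D m.+1 M x y z p)
  (at level 8, x, y, z at level 99, p at level 8).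
Local Notation collinp p q r := (collin (pvec hD p) (pvec hD q) (pvec hD r)).

Lemma has_coords_affE x y p : '[x, y, 1] p <-> exists2 c, c != 0 &
  [/\ X *m pvec hD p = rscale x c, ev fy (pvec hD p) = y * c & ev fz (pvec hD p) = c].
Proof.
split=> [/(has_coords_aff hD Mcoord coordM)[z0 yp xp]|[c c0 [xp yp zp]]].
  by exists (ev fz (pvec hD p)).
by apply/(has_coords_aff hD Mcoord coordM); rewrite zp.
Qed.

(** After the scalars of the representatives are absorbed, the last two coordinates force the
    coefficients of the relation to be [a', - a', a']; the vector part then reads
    [x - y - z = 0]. *)
Lemma collin_third x y z p q r : '[x, 0, 1] p -> '[y, 1, 1] q -> '[- z, 1, 0] r ->
  collinp p q r -> z = x - y.
Proof.
move=> /has_coords_affE[cp cp0 [xp yp zp]] /has_coords_affE[cq cq0 [xq yq zq]].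
move=> /(has_coords_inf hD Mcoord coordM)[yr zr xr] [a [b [c [E abc]]]].
have := congr1 (ev fz) E; have := congr1 (ev fy) E; have := congr1 (mulmx X) E.
rewrite !mulmxDr !mulmx_rscale !evD !ev_rscale xp xq xr yp yq zr zp zq.
rewrite !(mul0r, mul1r) mulmx0 !ev0 !rscaleA addr0 add0r.
have := @skew_mul_neq0 D hD cp a cp0.
have := @skew_mul_neq0 D hD cq b cq0.
have := @skew_mul_neq0 D hD (ev fy (pvec hD r)) c yr.
move: (cp * a) (cq * b) (ev fy (pvec hD r) * c) => a' b' c' hc hb ha xE bc ab.
have bE : b' = - a' by apply/eqP; rewrite -addr_eq0 addrC ab.
have cE : c' = a' by apply/eqP; rewrite -subr_eq0 addrC -bE bc.
have a0 : a' != 0.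
  by case: abc; [exact: ha|move/hb; rewrite bE oppr_eq0|move/hc; rewrite cE].
move: xE; rewrite bE cE rscaleNr -rscaleNl -!rscaleDl => /(rscale_eq0r hD a0)/eqP.
by rewrite subr_eq0 => /eqP.
Qed.

(** The last two coordinates give the coefficients [- (1 - a) u'], [- a u'] and [u'], up to the
    scalars of the representatives; cancelling [u'] on the right leaves the weights [1 - a] and
    [a]. *)
Lemma collin_affine x y z a p q r : '[x, 0, 1] p -> '[y, 1, 1] q -> '[z, a, 1] r ->
  collinp p q r -> z = rscale x (1 - a) + rscale y a.
Proof.
move=> /has_coords_affE[cp cp0 [xp yp zp]] /has_coords_affE[cq cq0 [xq yq zq]].
move=> /has_coords_affE[cr cr0 [xr yr zr]] [s [t [u [E stu]]]].
have := congr1 (ev fz) E; have := congr1 (ev fy) E; have := congr1 (mulmx X) E.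
rewrite !mulmxDr !mulmx_rscale !evD !ev_rscale xp xq xr yp yq yr zr zp zq.
rewrite !(mul0r, mul1r) mulmx0 !ev0 !rscaleA add0r -[a * cr * u]mulrA.
have := @skew_mul_neq0 D hD cp s cp0.
have := @skew_mul_neq0 D hD cq t cq0.
have := @skew_mul_neq0 D hD cr u cr0.
move: (cp * s) (cq * t) (cr * u) => s' t' u' hu ht hs xE yE zE.
have tE : t' = - (a * u') by apply/eqP; rewrite -addr_eq0 yE.
have sE : s' = - ((1 - a) * u').
  by apply/eqP; rewrite -addr_eq0 mulrBl mul1r -tE addrA addrAC zE.
have u0 : u' != 0.
  case: stu; [move/hs|move/ht|exact: hu].
    by rewrite sE; apply: contra_neq => ->; rewrite mulr0 oppr0.
  by rewrite tE; apply: contra_neq => ->; rewrite mulr0 oppr0.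
have zu : rscale z u' = rscale (rscale x (1 - a) + rscale y a) u'.
  rewrite rscaleDl !rscaleA; apply/eqP; rewrite -subr_eq0 opprD addrC.
  by rewrite -!rscaleNr -sE -tE xE.
by rewrite -(rscaleK hD z u0) zu rscaleK.
Qed.

Lemma aff_coord_inj x x' y p : '[x, y, 1] p -> '[x', y, 1] p -> x = x'.
Proof.
move=> /has_coords_affE[c c0 [xp _ zp]] /has_coords_affE[c' _ [xp' _ zp']].
by rewrite -(rscaleK hD x c0) -xp xp' -zp' zp rscaleK.
Qed.

Lemma coords_unique x y z (p q : pt) : '[x, y, z] p -> '[x, y, z] q -> p = q.
Proof. by move=> pE qE; apply: ppoint_eq; rewrite pE qE. Qed.

Lemma aff_coords_ex a p : ev fz (pvec hD p) != 0 ->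
  ev fy (pvec hD p) = a * ev fz (pvec hD p) -> exists x, '[x, a, 1] p.
Proof.
move=> z0 yp; exists (rscale (X *m pvec hD p) (ev fz (pvec hD p))^-1).
by apply/(has_coords_aff hD Mcoord coordM); rewrite rscaleVK.
Qed.

Lemma inf_coords_ex p : ev fy (pvec hD p) != 0 -> ev fz (pvec hD p) = 0 ->
  exists x, '[- x, 1, 0] p.
Proof.
move=> y0 zp; exists (- rscale (X *m pvec hD p) (ev fy (pvec hD p))^-1).
by apply/(has_coords_inf hD Mcoord coordM); rewrite opprK rscaleVK.
Qed.

Lemma card_coords y z (W : set pt) n : W #= `I_n ->
  (forall p, W p -> exists x, '[x, y, z] p) ->
  (forall x x' p, '[x, y, z] p -> '[x', y, z] p -> x = x') ->
  [set x | exists2 p, W p & '[x, y, z] p] #= `I_n.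
Proof.
move=> Wn Wex uniq.
have /choice[c cP] : forall p, exists x, W p -> '[x, y, z] p.
  move=> p; have [/Wex[x xp]|Wp] := pselect (W p); first by exists x.
  by exists 0.
have -> : [set x | exists2 p, W p & '[x, y, z] p] = c @` W.
  apply/seteqP; split=> [x [p Wp xp]|_ [p Wp <-]] /=.
    by exists p => //; apply: uniq xp; apply: cP.
  by exists p => //; apply: cP.
apply: card_inj_image Wn => p q /set_mem Wp /set_mem Wq cpq.
by apply: coords_unique (cP p Wp) _; rewrite cpq; apply: cP.
Qed.

(** * The group law carried by three coaxial parts *)

Section Group.
Variables W1 W2 W3 : set pt.
Let G1 := [set g | exists2 p, W1 p & '[g, 0, 1] p].
Let G2 := [set g | exists2 p, W2 p & '[g, 1, 1] p].
Let G3 := [set g | exists2 p, W3 p & '[- g, 1, 0] p].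
Hypothesis W1_coords : forall p, W1 p -> exists g, '[g, 0, 1] p.
Hypothesis W2_coords : forall p, W2 p -> exists g, '[g, 1, 1] p.
Hypothesis W3_coords : forall p, W3 p -> exists g, '[- g, 1, 0] p.
Hypothesis J12 : forall p q, W1 p -> W2 q -> exists2 r, W3 r & collinp p q r.
Hypothesis J13 : forall p r, W1 p -> W3 r -> exists2 q, W2 q & collinp p q r.
Hypothesis J23 : forall q r, W2 q -> W3 r -> exists2 p, W1 p & collinp p q r.
Hypothesis G1_0 : G1 0.
Hypothesis G2_0 : G2 0.

Let G12 x y : G1 x -> G2 y -> G3 (x - y).
Proof.
move=> [p Wp xp] [q Wq yq]; have [r Wr pqr] := J12 Wp Wq.
have [z zr] := W3_coords Wr.
by rewrite -(collin_third xp yq zr pqr); exists r.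
Qed.

Let G13 x z : G1 x -> G3 z -> G2 (x - z).
Proof.
move=> [p Wp xp] [r Wr zr]; have [q Wq pqr] := J13 Wp Wr.
have [y yq] := W2_coords Wq.
by rewrite (collin_third xp yq zr pqr) opprB addrC subrK; exists q.
Qed.

Let G23 y z : G2 y -> G3 z -> G1 (z + y).
Proof.
move=> [q Wq yq] [r Wr zr]; have [p Wp pqr] := J23 Wq Wr.
have [x xp] := W1_coords Wp.
by rewrite (collin_third xp yq zr pqr) subrK; exists p.
Qed.

Lemma assoc_group3 : G3 = G1.
Proof.
apply/seteqP; split=> g Gg; first by have := G23 G2_0 Gg; rewrite addr0.
by have := G12 Gg G2_0; rewrite subr0.
Qed.

Lemma assoc_subgroup : is_subgroup G1.
Proof.
split=> // z x Gz Gx; rewrite -assoc_group3 in Gz.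
(* Join [x] on the first part to [z] on the third, then join the resulting [x - z] on the second
   part to the origin [0] of the first: this yields [0 - (x - z)]. *)
have := G12 G1_0 (G13 Gx Gz).
by rewrite assoc_group3 sub0r opprB.
Qed.

Lemma assoc_group2 : G2 = G1.
Proof.
have G1N g : G1 g -> G1 (- g).
  by move=> Gg; rewrite -sub0r; apply: assoc_subgroup.2.
apply/seteqP; split=> g Gg.
  by rewrite -[g]opprK; apply: G1N; rewrite -assoc_group3 -sub0r; apply: G12.
by rewrite -[g]opprK -sub0r; apply: G13 => //; rewrite assoc_group3; apply: G1N.
Qed.

Section FourthPart.
Variables (W4 : set pt) (a : D) (n : nat).
Hypothesis W4_coords : forall p, W4 p -> exists g, '[g, a, 1] p.
Hypothesis J124 : forall p q, W1 p -> W2 q -> exists2 r, W4 r & collinp p q r.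
Hypotheses (W1n : W1 #= `I_n) (W4n : W4 #= `I_n).

Let G4 := [set g | exists2 p, W4 p & '[g, a, 1] p].

Let G124 x y : G1 x -> G2 y -> G4 (rscale x (1 - a) + rscale y a).
Proof.
move=> [p Wp xp] [q Wq yq]; have [r Wr pqr] := J124 Wp Wq.
have [z zr] := W4_coords Wr.
by rewrite -(collin_affine xp yq zr pqr); exists r.
Qed.

(** Joining equal elements [g] of [G1] and [G2] gives [g (1 - a) + g a = g] in [G4]; equality of the
    sizes does the rest. Joining [0] to [g] will then show that [g a] lies in [G1]. *)
Lemma assoc_group4 : G4 = G1.
Proof.
symmetry; apply: card_sub_eq (_ : _ #= `I_n) (_ : _ #= `I_n).
- move=> g Gg; have G2g : G2 g by rewrite assoc_group2.
  by have := G124 Gg G2g; rewrite -rscaleDr subrK rscale1.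
- by apply: card_coords => // x x' p; apply: aff_coord_inj.
- by apply: card_coords => // x x' p; apply: aff_coord_inj.
Qed.

Lemma assoc_stab : stab_scalars G1 a.
Proof.
move=> g Gg; rewrite -assoc_group4 -[rscale g a]add0r -(rscale0l _ (1 - a)).
by apply: G124 => //; rewrite assoc_group2.
Qed.

End FourthPart.
End Group.
End Collinear.

(** * Three hyperplanes with a transversal point *)

Section Triangle.
Variable D : unitRingType.
Hypothesis hD : GRing.field_axiom D.
Variable d : nat.
Variables f1 f2 f3 : 'rV[D]_d.

Lemma skew_mul_eq0l (x y : D) : x != 0 -> x * y = 0 -> y = 0.
Proof. by move=> x0 /(skew_mulf_eq0 hD)[/eqP|//]; rewrite (negPf x0). Qed.

Lemma skew_mul_eq0r (x y : D) : y != 0 -> x * y = 0 -> x = 0.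
Proof. by move=> y0 /(skew_mulf_eq0 hD)[//|/eqP]; rewrite (negPf y0). Qed.

(** Menelaus' theorem in the order that noncommutativity dictates. Apply the three forms to the
    relation and follow [f1 y * t] around the triangle: [b] changes [f1] into [f3] at [y], [a]
    changes [f3] into [f2] at [x], and [c] changes [f2] into [f1] at [z]. Each passage to another
    vertex costs a sign, three in all. *)
Lemma collin_product x y z a b c :
  ev f1 x = 0 -> ev f2 y = 0 -> ev f3 z = 0 ->
  ev f2 x != 0 -> ev f1 y != 0 -> ev f1 z != 0 ->
  ev f2 x = a * ev f3 x -> ev f3 y = b * ev f1 y -> ev f1 z = c * ev f2 z ->
  collin x y z -> c * (a * b) = -1.
Proof.
move=> x1 y2 z3 x2 y1 z1 xa yb zc [s [t [u [E stu]]]].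
have := congr1 (ev f3) E; have := congr1 (ev f2) E; have := congr1 (ev f1) E.
rewrite !evD !ev_rscale !ev0 x1 y2 z3 !mul0r add0r !addr0 => E1 E2 E3.
have t0 : t != 0.
  apply/eqP => t0.
  have u0 : u = 0 by apply: (skew_mul_eq0l z1); rewrite -E1 t0 mulr0 add0r.
  have s0 : s = 0 by apply: (skew_mul_eq0l x2); rewrite -E2 u0 mulr0 addr0.
  by move: stu; rewrite s0 t0 u0 eqxx; case.
have yt0 := skew_mul_neq0 hD y1 t0.
apply/eqP; rewrite -addr_eq0; apply/eqP; apply: (skew_mul_eq0r yt0).
rewrite mulrDl mul1r addrC -{1}[_ * t](addrK (ev f1 z * u)) E1 sub0r zc.
have xs : ev f2 x * s = - (ev f2 z * u) by apply/eqP; rewrite -addr_eq0 E2.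
have yt : ev f3 y * t = - (ev f3 x * s) by apply/eqP; rewrite -addr_eq0 addrC E3.
rewrite -[c * (a * b) * _]mulrA -[a * b * _]mulrA [b * (_ * _)]mulrA -yb yt mulrN mulrA -xa.
by rewrite xs opprK -mulrA addNr.
Qed.

(** As all forms are 1 at [o], the first two give [f1 y * u = f2 x * s = - t]; the third becomes
    [(1 - a - b) * t = 0]. *)
Lemma collin_perspective x o y a b :
  ev f1 o = 1 -> ev f2 o = 1 -> ev f3 o = 1 ->
  ev f1 x = 0 -> ev f2 y = 0 -> ev f2 x != 0 -> ev f1 y != 0 ->
  ev f3 x = a * ev f2 x -> ev f3 y = b * ev f1 y ->
  collin x o y -> b = 1 - a.
Proof.
move=> o1 o2 o3 x1 y2 x2 y1 xa yb [s [t [u [E stu]]]].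
have := congr1 (ev f3) E; have := congr1 (ev f2) E; have := congr1 (ev f1) E.
rewrite !evD !ev_rscale !ev0 x1 y2 o1 o2 o3 !mul0r add0r !addr0 !mul1r => E1 E2.
have ys : ev f1 y * u = - t by apply/eqP; rewrite -addr_eq0 addrC E1.
have xs : ev f2 x * s = - t by apply/eqP; rewrite -addr_eq0 E2.
rewrite xa yb -!mulrA ys xs => E3.
have t0 : t != 0.
  apply/eqP => t0.
  have u0 : u = 0 by apply: (skew_mul_eq0l y1); rewrite ys t0 oppr0.
  have s0 : s = 0 by apply: (skew_mul_eq0l x2); rewrite xs t0 oppr0.
  by move: stu; rewrite s0 t0 u0 eqxx; case.
apply/eqP; rewrite eq_sym -subr_eq0; apply/eqP; apply: (skew_mul_eq0r t0).
by rewrite !mulrBl mul1r -E3 !mulrN [_ + t]addrC.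
Qed.

End Triangle.

Section TriangleOfPoints.
Variable D : unitRingType.
Hypothesis hD : GRing.field_axiom D.
Variable d : nat.
Local Notation pt := (ppoint D d).
Local Notation collinp p q r := (collin (pvec hD p) (pvec hD q) (pvec hD r)).
Local Notation evp f p := (ev f (pvec hD p)).
Variables (f1 f2 f3 : 'rV[D]_d.+1) (W1 W2 W3 : set pt) (o : pt).
Hypotheses (o1 : evp f1 o = 1) (o2 : evp f2 o = 1) (o3 : evp f3 o = 1).
Hypothesis W1_on : forall x, W1 x -> [/\ evp f1 x = 0, evp f2 x != 0 & evp f3 x != 0].
Hypothesis W2_on : forall y, W2 y -> [/\ evp f2 y = 0, evp f1 y != 0 & evp f3 y != 0].
Hypothesis W3_on : forall z, W3 z -> [/\ evp f3 z = 0, evp f1 z != 0 & evp f2 z != 0].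
Hypothesis J12 : forall x y, W1 x -> W2 y -> exists2 z, W3 z & collinp x y z.
Hypothesis J13 : forall x z, W1 x -> W3 z -> exists2 y, W2 y & collinp x y z.
Hypothesis J23 : forall y z, W2 y -> W3 z -> exists2 x, W1 x & collinp x y z.
Hypothesis J1o : forall x, W1 x -> exists2 y, W2 y & collinp x o y.
Hypothesis J2o : forall y, W2 y -> exists2 x, W1 x & collinp x o y.
Hypotheses (W1_fin : finite_set W1) (W1_neq0 : W1 !=set0).

(** The constancy of the ratio [f2 / f3] on [W1] and of [f3 / f1] on [W2] is the form of degeneracy
    from which a hyperplane through all points can be written down. *)
Lemma triangle_coplanar : exists a0 b0, [/\ a0 != 0,
  forall x, W1 x -> evp f2 x = a0 * evp f3 x
  & forall y, W2 y -> evp f3 y = b0 * evp f1 y].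
Proof.
pose a x := evp f2 x / evp f3 x; pose b y := evp f3 y / evp f1 y.
pose c z := evp f1 z / evp f2 z.
have aE x : W1 x -> evp f2 x = a x * evp f3 x.
  by move=> /W1_on[_ _ x3]; rewrite /a mulrVK ?hD.
have bE y : W2 y -> evp f3 y = b y * evp f1 y.
  by move=> /W2_on[_ y1 _]; rewrite /b mulrVK ?hD.
have cE z : W3 z -> evp f1 z = c z * evp f2 z.
  by move=> /W3_on[_ _ z2]; rewrite /c mulrVK ?hD.
have a0 x : W1 x -> a x != 0.
  by move=> /W1_on[_ x2 x3]; rewrite skew_mul_neq0 ?skew_inv_neq0.
have b0 y : W2 y -> b y != 0.
  by move=> /W2_on[_ y1 y3]; rewrite skew_mul_neq0 ?skew_inv_neq0.
have c0 z : W3 z -> c z != 0.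
  by move=> /W3_on[_ z1 z2]; rewrite skew_mul_neq0 ?skew_inv_neq0.
(* The perspectivity compares [f3 / f2] on [W1] with [f3 / f1] on [W2], whereas Menelaus uses
   [f2 / f3]; hence the inverse in [b = 1 - a^-1]. *)
have aV x : W1 x -> evp f3 x = (a x)^-1 * evp f2 x.
  by move=> Wx; rewrite (aE x Wx) mulKr // hD ?a0.
have abc x y z : W1 x -> W2 y -> W3 z -> collinp x y z -> - (c z)^-1 = a x * b y.
  move=> Wx Wy Wz xyz; have [x1 x2 _] := W1_on Wx; have [y2 y1 _] := W2_on Wy.
  have [z3 z1 _] := W3_on Wz; have uc := hD (c0 z Wz).
  have := collin_product hD x1 y2 z3 x2 y1 z1 (aE x Wx) (bE y Wy) (cE z Wz) xyz.
  by move=> cab; apply: (mulrI uc); rewrite cab mulrN divrr.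
have ab x y : W1 x -> W2 y -> collinp x o y -> b y = 1 - (a x)^-1.
  move=> Wx Wy xoy; have [x1 x2 _] := W1_on Wx; have [y2 y1 _] := W2_on Wy.
  exact: (collin_perspective hD o1 o2 o3 x1 y2 x2 y1 (aV x Wx) (bE y Wy) xoy).
have [A AE] : exists A : seq D, a @` W1 = [set` A].
  by apply/finite_seqP; apply: finite_image.
have memA e : reflect (exists2 x, W1 x & e = a x) (e \in undup A).
  rewrite mem_undup; apply: (iffP idP) => [eA|[x Wx ->]].
    have : (a @` W1) e by rewrite AE.
    by move=> [x Wx <-]; exists x.
  by have : (a @` W1) (a x) by [exists x]; rewrite AE.
pose B := [seq 1 - e^-1 | e <- undup A].
have memB e : reflect (exists2 y, W2 y & e = b y) (e \in B).
  apply: (iffP mapP) => [[_ /memA[x Wx ->] ->]|[y Wy ->]].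
    by have [y Wy xoy] := J1o Wx; exists y => //; rewrite (ab x y).
  have [x Wx xoy] := J2o Wy; exists (a x); last exact: ab.
  by apply/memA; exists x.
have [szA|szA] := ltnP 1 (size (undup A)).
  (* The common product set consists of the values [- c^-1] on [W3]. Every point of [W3] is reached
     from a fixed point of [W2] and from a fixed point of [W1], so all of it occurs both as [A * b]
     and as [a * B]. *)
  exfalso; apply: (@no_product_triangle D hD (undup A) B
    (fun e => exists2 z, W3 z & e = - (c z)^-1)) => //.
  - exact: undup_uniq.
  - rewrite map_inj_uniq ?undup_uniq // => s t /addrI/oppr_inj; exact: invr_inj.
  - by apply/negP => /memA[x /a0 ax0 /esym/eqP]; rewrite (negPf ax0).
  - by apply/negP => /memB[y /b0 by0 /esym/eqP]; rewrite (negPf by0).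
  - move=> _ /memB[y Wy ->] e; split=> [[z Wz ->]|[_ /memA[x Wx ->] ->]].
      have [x Wx xyz] := J23 Wy Wz; exists (a x); last exact: abc.
      by apply/memA; exists x.
    by have [z Wz xyz] := J12 Wx Wy; exists z => //; rewrite (abc x y z).
  - move=> _ /memA[x Wx ->] e; split=> [[z Wz ->]|[_ /memB[y Wy ->] ->]].
      have [y Wy xyz] := J13 Wx Wz; exists (b y); last exact: abc.
      by apply/memB; exists y.
    by have [z Wz xyz] := J12 Wx Wy; exists z => //; rewrite (abc x y z).
have [x0 Wx0] := W1_neq0.
have aA x : W1 x -> a x = a x0.
  move=> Wx; have /memA : exists2 x', W1 x' & a x = a x' by exists x.
  have /memA : exists2 x', W1 x' & a x0 = a x' by exists x0.
  by case: (undup A) szA => [|e [|]] // _; rewrite !inE => /eqP -> /eqP ->.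
exists (a x0), (1 - (a x0)^-1); split; first exact: a0.
  by move=> x Wx; rewrite aE // aA.
by move=> y Wy; have [x Wx xoy] := J2o Wy; rewrite bE // (ab x y) // aA.
Qed.

End TriangleOfPoints.

(** * Finite additive subgroups *)

Section FiniteSubgroups.
Variable D : unitRingType.
Hypothesis hD : GRing.field_axiom D.
Variables (m n : nat) (G : set 'cV[D]_m).
Hypotheses (Gn : G #= `I_n) (Ggrp : is_subgroup G) (n_gt1 : (1 < n)%N).

Lemma subgroup_opp g : G g -> G (- g).
Proof. by move=> Gg; rewrite -sub0r; apply: Ggrp.2 => //; exact: Ggrp.1. Qed.

Lemma subgroup_add g h : G g -> G h -> G (g + h).
Proof. by move=> Gg Gh; rewrite -[h]opprK; apply: Ggrp.2 => //; apply: subgroup_opp. Qed.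

Lemma subgroup_nontrivial : exists2 g, G g & g != 0.
Proof.
apply: contrapT => G0.
have : G `<=` [set 0].
  by move=> g Gg; apply: contrapT => /eqP g0; apply: G0; exists g.
move=> /subset_card_le; rewrite (card_le_eql Gn) (card_le_eqr card_set1).
by rewrite card_le_II leqNgt n_gt1.
Qed.

(* Translation by [g] permutes G, so summing over G gives [|G| g = 0]. *)
Lemma subgroup_pchar : exists p, p \in [pchar D].
Proof.
have [g Gg g0] := subgroup_nontrivial.
have Gfin : finite_set G by apply/finite_setP; exists n.
have [s0 GE] := (@finite_seqP _ G).1 Gfin.
pose s := undup s0.
have memG x : G x <-> x \in s by rewrite mem_undup GE.
have ps : perm_eq [seq x + g | x <- s] s.
  apply: uniq_perm; first by rewrite map_inj_uniq ?undup_uniq //; exact: addIr.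
    exact: undup_uniq.
  move=> x; apply/mapP/idP => [[y /memG Gy ->]|/memG Gx].
    by apply/memG/subgroup_add.
  by exists (x - g); [apply/memG/Ggrp.2|rewrite subrK].
have s_gt0 : (0 < size s)%N.
  by rewrite -has_predT; apply/hasP; exists g => //; apply/memG.
have /(skew_pchar hD s_gt0)[p _ pD] : (size s)%:R = 0 :> D; last by exists p.
have : rscale g (size s)%:R = 0.
  rewrite rscaleMn; have := perm_big _ ps (F := fun x => x) (P := xpredT) (op := +%R) (x := 0).
  rewrite big_map big_split /= => /eqP.
  by rewrite -subr_eq0 addrAC subrr add0r big_const_seq count_predT iter_addr_0 => /eqP.
exact: rscale_eq0.
Qed.

Lemma stab0 : stab_scalars G 0.
Proof. by move=> g _; rewrite rscale0; exact: Ggrp.1. Qed.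

Lemma stab1 : stab_scalars G 1.
Proof. by move=> g; rewrite rscale1. Qed.

Lemma stabB a b : stab_scalars G a -> stab_scalars G b -> stab_scalars G (a - b).
Proof.
by move=> Sa Sb g Gg; rewrite rscaleDr rscaleNr; apply: Ggrp.2; [exact: Sa|exact: Sb].
Qed.

(** Right multiplication by [a] maps the finite set [G] injectively to itself, hence onto. *)
Lemma stabV a : stab_scalars G a -> a != 0 -> stab_scalars G a^-1.
Proof.
move=> Sa a0 g Gg.
have GaE : (fun g => rscale g a) @` G = G.
  apply: card_sub_eq Gn; first by move=> _ [h Gh <-]; exact: Sa.
  apply: card_inj_image Gn => x y _ _ xy.
  by rewrite -(rscaleK hD x a0) xy rscaleK.
by move: Gg; rewrite -{1}GaE => -[h Gh <-]; rewrite rscaleK.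
Qed.

(** For a fixed nonzero [g] in [G], the map sending [a] to [g a] embeds [D_G] into [G]. *)
Lemma stab_card : exists2 q, stab_scalars G #= `I_q & (q <= n)%N.
Proof.
have [g Gg g0] := subgroup_nontrivial.
have sub : rscale g @` stab_scalars G `<=` G by move=> _ [a Sa <-]; exact: Sa.
have inj : set_inj (stab_scalars G) (rscale g) by move=> a b _ _; apply: rscaleI.
have Sle : stab_scalars G #<= `I_n.
  rewrite -(card_le_eql (inj_card_eq inj)) -(card_le_eqr Gn).
  exact: subset_card_le.
have /finite_setP[q Sq] : finite_set (stab_scalars G) by apply/finite_set_leP; exists n.
by exists q => //; rewrite -card_le_II -(card_le_eql Sq).
Qed.

(** Multiplication by the characteristic [p] kills both [G] and [D_G], so both are elementary
    abelian; [t <= e] restates [|D_G| <= |G|]. *)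
Lemma stab_primepower : exists p e t : nat,
  [/\ prime p /\ n = (p ^ e)%N,
      exists f : {additive 'rV['Z_p]_e -> 'cV[D]_m}, injective f /\ range f = G,
      stab_scalars G #= `I_(p ^ t)%N & (t <= e)%N].
Proof.
have [p pD] := subgroup_pchar; have pp := pcharf_prime pD.
have [q Sq qn] := stab_card.
have [|e [nE fE]] := elementary_abelian pp Gn Ggrp.1 Ggrp.2.
  by move=> g _; rewrite -rscaleMn (pcharf0 pD) rscale0.
have [|t [qE _]] := elementary_abelian pp Sq stab0 stabB.
  by move=> a _; rewrite -mulr_natr (pcharf0 pD) mulr0.
exists p, e, t; split=> //; first by rewrite -qE.
by move: qn; rewrite nE qE leq_exp2l ?prime_gt1.
Qed.

End FiniteSubgroups.

(** * Embedded transversal designs *)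

Section EmbeddedTD.
Variable D : unitRingType.
Hypothesis hD : GRing.field_axiom D.
Variables (m k n : nat).
Local Notation pt := (ppoint D m.+1).
Variables (V : set pt) (P B : set (set pt)) (H : nat -> set pt) (ell : set pt -> set pt).
Hypothesis TD : is_TD k n V P B.
Hypothesis emb : embedded k V P B H ell.
Local Notation collinp p q r := (collin (pvec hD p) (pvec hD q) (pvec hD r)).
Local Notation evp f p := (ev f (pvec hD p)).
Local Notation W i := (V `&` H i).

Let PE : P = [set W i | i in index_range 1 k]. Proof. by case: emb. Qed.

Lemma emb_forms : exists F : nat -> 'rV[D]_m.+2,
  forall i, index_range 1 k i -> F i != 0 /\ H i = hpl hD (F i).
Proof.
have /choice[F FP] : forall i, exists f : 'rV[D]_m.+2,
    index_range 1 k i -> f != 0 /\ H i = hpl hD f.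
  move=> i; have [ik|ik] := pselect (index_range 1 k i); last by exists 0.
  case: emb => -[/(_ i ik)/(is_hyperplaneP hD)[f f0 HE] _] _ _ _ _.
  by exists f.
by exists F.
Qed.

Lemma emb_on_join b x y z : B b -> b x -> b y -> b z -> x <> y ->
  joinline hD x y z.
Proof.
move=> Bb bx by_ bz xy; case: emb => _ _ /(_ b Bb)[bl bsub] _ _.
by rewrite -(line_joinE hD bl (bsub _ bx) (bsub _ by_) xy); apply: bsub.
Qed.

Lemma emb_neq i j x y : index_range 1 k i -> index_range 1 k j -> i <> j ->
  W i x -> W j y -> x <> y.
Proof.
move=> ik jk ij Wx Wy xy; apply: ij; apply: (TD_part_disj TD PE ik jk Wx).
by rewrite xy.
Qed.

Lemma emb_join i j l x y : index_range 1 k i -> index_range 1 k j ->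
  index_range 1 k l -> i <> j -> W i x -> W j y ->
  exists2 z, W l z & joinline hD x y z.
Proof.
move=> ik jk lk ij Wx Wy; have xy := emb_neq ik jk ij Wx Wy.
have [b [[Bb [bx by_]] _]] := TD_join TD PE ik jk ij Wx Wy.
have [z [bz Wz]] := TD_block_meet TD PE Bb lk.
by exists z => //; apply: emb_on_join bz xy.
Qed.

Lemma emb_collin i j l x y : index_range 1 k i -> index_range 1 k j ->
  index_range 1 k l -> i <> j -> W i x -> W j y ->
  exists2 z, W l z & collinp x y z.
Proof.
move=> ik jk lk ij Wx Wy; have [z Wz xyz] := emb_join ik jk lk ij Wx Wy.
by exists z => //; apply: joinline_collin.
Qed.

Lemma emb_off i j x : index_range 1 k i -> index_range 1 k j -> i <> j ->
  W i x -> ~ H j x.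
Proof.
move=> ik jk ij Wx Hx; apply: ij; apply: (TD_part_disj TD PE ik jk Wx).
by split=> //; case: Wx.
Qed.

Lemma emb_part_neq0 i : index_range 1 k i -> W i !=set0.
Proof.
move=> ik; have Pi := TD_part PE ik.
by case: TD => _ _ [[_ _ ne] _ _] _ _; exact: ne Pi.
Qed.

(** A point outside [W i] is joined by a block to a point of [W i], and this block also meets [W j];
    its line is thus spanned by two points of the hyperplane. *)
Lemma emb_spanned (f : 'rV[D]_m.+2) i j :
  index_range 1 k i -> index_range 1 k j -> i <> j ->
  W i `<=` hpl hD f -> W j `<=` hpl hD f -> V `<=` hpl hD f.
Proof.
move=> ik jk ij Wi Wj z Vz.
have [l lk Wz] := TD_part_cover TD PE Vz.
have [il|il] := pselect (i = l); first by apply: Wi; rewrite il.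
have [x Wx] := emb_part_neq0 ik.
have [b [[Bb [bx bz]] _]] := TD_join TD PE ik lk il Wx Wz.
have [y [by_ Wy]] := TD_block_meet TD PE Bb jk.
have [s [t zE]] := emb_on_join Bb bx by_ bz (emb_neq ik jk ij Wx Wy).
rewrite /hpl /= zE evD !ev_rscale.
by rewrite (Wi _ Wx : evp f x = 0) (Wj _ Wy : evp f y = 0) !mul0r addr0.
Qed.

Section Forms.
Variable F : nat -> 'rV[D]_m.+2.
Hypothesis HF : forall i, index_range 1 k i -> F i != 0 /\ H i = hpl hD (F i).

Lemma emb_on i x : index_range 1 k i -> W i x -> evp (F i) x = 0.
Proof. by move=> ik [_]; rewrite (HF ik).2. Qed.

Lemma emb_off_neq0 i j x : index_range 1 k i -> index_range 1 k j -> i <> j ->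
  W i x -> evp (F j) x != 0.
Proof.
by move=> ik jk ij Wx; apply/eqP => fx; apply: (emb_off ik jk ij Wx); rewrite (HF jk).2.
Qed.

Lemma emb_coaxial i j l o : is_proper V ->
  index_range 1 k i -> index_range 1 k j -> index_range 1 k l -> index_range 1 k o ->
  i <> j -> i <> l -> j <> l -> i <> o -> j <> o -> l <> o ->
  forall v, ev (F i) v = 0 -> ev (F j) v = 0 -> ev (F l) v = 0.
Proof.
move=> prop ik jk lk ok ij il jl io jo lo v vi vj; apply: contrapT => /eqP vl.
have [q Wq] := emb_part_neq0 ok.
(* The point [q] of the part [o] is the centre of perspectivity; it lies on none of the three
   hyperplanes, so the forms can be scaled to be 1 at it. *)
pose g e := (evp (F e) q)^-1 *: F e.
have q0 e : index_range 1 k e -> e <> o -> evp (F e) q != 0.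
  by move=> ek eo; apply: emb_off_neq0 ok ek _ Wq => /esym.
have g1 e : index_range 1 k e -> e <> o -> evp (g e) q = 1.
  by move=> ek eo; rewrite evZl mulVr // hD ?q0.
have gon e x : index_range 1 k e -> W e x -> evp (g e) x = 0.
  by move=> ek We; rewrite evZl (emb_on ek We) mulr0.
have goff e e' x : index_range 1 k e -> index_range 1 k e' -> e <> e' -> e' <> o ->
    W e x -> evp (g e') x != 0.
  move=> ek ek' ee' eo Wx; rewrite evZl skew_mul_neq0 ?skew_inv_neq0 ?q0 //.
  exact: emb_off_neq0 ek ek' ee' Wx.
have W_fin e : index_range 1 k e -> finite_set (W e).
  by move=> ek; apply/finite_setP; exists n; exact: TD_part_card TD PE _ ek.
have [a0 [b0 [a0n abx aby]]] : exists a0 b0, [/\ a0 != 0,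
    forall x, W i x -> evp (g j) x = a0 * evp (g l) x
    & forall y, W j y -> evp (g l) y = b0 * evp (g i) y].
  apply: (@triangle_coplanar D hD m.+1 (g i) (g j) (g l) (W i) (W j) (W l) q).
  - exact: g1.
  - exact: g1.
  - exact: g1.
  - by move=> x Wx; split; [apply: gon|apply: (goff i)|apply: (goff i)].
  - by move=> x Wx; split; [apply: gon|apply: (goff j) => // /esym|apply: (goff j)].
  - by move=> x Wx; split; [apply: gon|apply: (goff l) => // /esym|apply: (goff l) => // /esym].
  - by move=> x y; apply: emb_collin.
  - move=> x z Wx Wz; have [y Wy xzy] := emb_collin ik lk jk il Wx Wz.
    by exists y => //; apply/collin_swap/collin_perm/collin_perm.
  - move=> y z Wy Wz; have [x Wx yzx] := emb_collin jk lk ik jl Wy Wz.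
    by exists x => //; apply/collin_perm/collin_perm.
  - by move=> x Wx; exact: (emb_collin ik ok jk io Wx Wq).
  - move=> y Wy; have [x Wx qyx] := emb_collin ok jk ik (nesym jo) Wq Wy.
    by exists x => //; apply/collin_perm/collin_perm.
  - exact: W_fin.
  - exact: emb_part_neq0.
(* On [W i], [g i] vanishes and [g j = a0 * g l]; on [W j], [g j] vanishes and [g l = b0 * g i].
   Hence [f] vanishes on both parts, while at [v] only the term in [g l] survives, so [f] is not the
   zero form. *)
pose f : 'rV[D]_m.+2 := (a0 * b0) *: g i + g j - a0 *: g l.
have fE u : ev f u = a0 * b0 * ev (g i) u + ev (g j) u - a0 * ev (g l) u.
  by rewrite /f evDl evDl evNl !evZl.
have f0 : f != 0.
  apply/eqP => f0; have : ev f v != 0; last by rewrite f0 /ev mul0mx mxE eqxx.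
  rewrite fE !evZl vi vj !mulr0 !add0r oppr_eq0.
  by rewrite !skew_mul_neq0 ?skew_inv_neq0 ?q0.
apply: (prop (hpl hD f)); first by apply/(is_hyperplaneP hD); exists f.
apply: (emb_spanned ik jk ij) => [x Wx|y Wy]; rewrite /hpl /= fE.
  by rewrite (gon _ _ ik Wx) mulr0 add0r abx // subrr.
by rewrite (gon _ _ jk Wy) addr0 aby // mulrA subrr.
Qed.

End Forms.
End EmbeddedTD.

(** * Coordinates of the parts on coaxial hyperplanes *)

Section NormalForm.
Variable D : unitRingType.
Hypothesis hD : GRing.field_axiom D.
Variables (m k n : nat).
Local Notation pt := (ppoint D m.+1).
Variables (V : set pt) (P B : set (set pt)) (H : nat -> set pt) (ell : set pt -> set pt).
Hypothesis TD : is_TD k n V P B.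
Hypothesis emb : embedded k V P B H ell.
Local Notation collinp p q r := (collin (pvec hD p) (pvec hD q) (pvec hD r)).
Local Notation evp f p := (ev f (pvec hD p)).
Local Notation W i := (V `&` H i).
Variables (M : 'M[D]_m.+2) (X : 'M[D]_(m, m.+2)) (fy fz : 'rV[D]_m.+2).
Hypothesis Mcoord : forall x y z, [/\ X *m (M *m @hvec D m.+1 x y z) = x,
  ev fy (M *m @hvec D m.+1 x y z) = y & ev fz (M *m @hvec D m.+1 x y z) = z].
Hypothesis coordM : forall v, v = M *m @hvec D m.+1 (X *m v) (ev fy v) (ev fz v).
Local Notation "''[' x , y , z ']' p" := (@has_coords D m.+1 M x y z p)
  (at level 8, x, y, z at level 99, p at level 8).
Hypotheses (H1E : H 1%N = hpl hD fy) (H2E : H 2%N = hpl hD (fy - fz))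
  (H3E : H 3%N = hpl hD fz).
Variables x0 y0 : pt.
Hypotheses (Wx0 : W 1%N x0) (x0E : '[0, 0, 1] x0).
Hypotheses (Wy0 : W 2%N y0) (y0E : '[0, 1, 1] y0).

Definition assoc_group : set 'cV[D]_m := [set g | exists2 p, W 1%N p & '[g, 0, 1] p].
Local Notation G := assoc_group.

Let k_ge3 : (3 <= k)%N. Proof. by case: TD => -[]. Qed.

Let ik1 : index_range 1 k 1%N. Proof. by apply/andP; split=> //; apply: ltnW (ltnW k_ge3). Qed.
Let ik2 : index_range 1 k 2%N. Proof. by apply/andP; split=> //; apply: ltnW k_ge3. Qed.
Let ik3 : index_range 1 k 3%N. Proof. exact/andP. Qed.
Let PE : P = [set W i | i in index_range 1 k]. Proof. by case: emb. Qed.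

Lemma part1_coords p : W 1%N p -> exists g, '[g, 0, 1] p.
Proof.
move=> Wp; have yp : evp fy p = 0 by case: Wp => _; rewrite H1E.
apply: (aff_coords_ex Mcoord coordM); last by rewrite yp mul0r.
by apply/eqP => zp; apply: (emb_off TD emb ik1 ik3 _ Wp) => //; rewrite H3E.
Qed.

Lemma part_aff_coords a i p : index_range 1 k i -> i <> 3%N ->
  H i = hpl hD (fy - a *: fz) -> W i p -> exists g, '[g, a, 1] p.
Proof.
move=> ik i3 HE Wp; have yp : evp fy p = a * evp fz p.
  case: Wp => _; rewrite HE /hpl /= evDl evNl evZl => /eqP.
  by rewrite subr_eq0 => /eqP.
apply: (aff_coords_ex Mcoord coordM) => //.
by apply/eqP => zp; apply: (emb_off TD emb ik ik3 i3 Wp) => //; rewrite H3E.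
Qed.

Lemma part2_coords p : W 2%N p -> exists g, '[g, 1, 1] p.
Proof. by apply: part_aff_coords => //; rewrite scale1r. Qed.

Lemma part3_coords p : W 3%N p -> exists g, '[- g, 1, 0] p.
Proof.
move=> Wp; have zp : evp fz p = 0 by case: Wp => _; rewrite H3E.
apply: (inf_coords_ex Mcoord coordM) => //.
by apply/eqP => yp; apply: (emb_off TD emb ik3 ik1 _ Wp) => //; rewrite H1E.
Qed.

Let J12 p q : W 1%N p -> W 2%N q -> exists2 r, W 3%N r & collinp p q r.
Proof. by move=> Wp Wq; apply: (emb_collin hD TD emb ik1 ik2 ik3 _ Wp Wq). Qed.

Let J13 p r : W 1%N p -> W 3%N r -> exists2 q, W 2%N q & collinp p q r.
Proof.
move=> Wp Wr; have [q Wq prq] := emb_collin hD TD emb ik1 ik3 ik2 (ltac:(done)) Wp Wr.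
by exists q => //; apply/collin_swap/collin_perm/collin_perm.
Qed.

Let J23 q r : W 2%N q -> W 3%N r -> exists2 p, W 1%N p & collinp p q r.
Proof.
move=> Wq Wr; have [p Wp qrp] := emb_collin hD TD emb ik2 ik3 ik1 (ltac:(done)) Wq Wr.
by exists p => //; apply/collin_perm/collin_perm.
Qed.

Let G1_0 : G 0. Proof. by exists x0. Qed.

Let G2_0 : [set g | exists2 p, W 2%N p & '[g, 1, 1] p] 0. Proof. by exists y0. Qed.

Lemma assoc_group_subgroup : is_subgroup G.
Proof.
exact: (assoc_subgroup Mcoord coordM part1_coords part2_coords part3_coords
  J12 J13 J23 G1_0 G2_0).
Qed.

Lemma assoc_group_card : G #= `I_n.
Proof.
apply: (card_coords (TD_part_card TD PE ik1) part1_coords) => x x' p.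
exact: (aff_coord_inj hD Mcoord coordM).
Qed.

Lemma part1E : W 1%N = [set p | exists2 g, G g & '[g, 0, 1] p].
Proof.
apply/seteqP; split=> [p Wp|p [g [q Wq gq] gp]].
  by have [g gp] := part1_coords Wp; exists g => //; exists p.
by rewrite (coords_unique gp gq).
Qed.

Lemma part2E : W 2%N = [set p | exists2 g, G g & '[g, 1, 1] p].
Proof.
have GE := assoc_group2 Mcoord coordM part1_coords part2_coords part3_coords
  J12 J13 J23 G1_0 G2_0.
apply/seteqP; split=> [p Wp|p [g]].
  have [g gp] := part2_coords Wp; exists g => //; rewrite /assoc_group -GE.
  by exists p.
by rewrite /assoc_group -GE => -[q Wq gq] gp; rewrite (coords_unique gp gq).
Qed.

Lemma part3E : W 3%N = [set p | exists2 g, G g & '[- g, 1, 0] p].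
Proof.
have GE := assoc_group3 Mcoord coordM part1_coords part3_coords
  J12 J23 G2_0.
apply/seteqP; split=> [p Wp|p [g]].
  have [g gp] := part3_coords Wp; exists g => //; rewrite /assoc_group -GE.
  by exists p.
by rewrite /assoc_group -GE => -[q Wq gq] gp; rewrite (coords_unique gp gq).
Qed.

Section OtherParts.
Variables (i : nat) (a : D).
Hypotheses (ik : index_range 4 k i) (HiE : H i = hpl hD (fy - a *: fz)).

Let ik' : index_range 1 k i.
Proof. by move: ik => /andP[i4 ik']; apply/andP; split=> //; apply: leq_trans i4. Qed.

Let i3 : i <> 3%N. Proof. by move=> i3; move: ik; rewrite i3 => /andP[]. Qed.

Let J12i p q : W 1%N p -> W 2%N q -> exists2 r, W i r & collinp p q r.
Proof. by move=> Wp Wq; apply: (emb_collin hD TD emb ik1 ik2 ik' _ Wp Wq). Qed.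

Lemma partiE : W i = [set p | exists2 g, G g & '[g, a, 1] p].
Proof.
have GE := assoc_group4 Mcoord coordM part1_coords part2_coords part3_coords
  J12 J13 J23 G1_0 G2_0 (fun p => part_aff_coords ik' i3 HiE (p := p)) J12i
  (TD_part_card TD PE ik1) (TD_part_card TD PE ik').
apply/seteqP; split=> [p Wp|p [g]].
  have [g gp] := part_aff_coords ik' i3 HiE Wp; exists g => //.
  by rewrite /assoc_group -GE; exists p.
by rewrite /assoc_group -GE => -[q Wq gq] gp; rewrite (coords_unique gp gq).
Qed.

Lemma parti_stab : stab_scalars G a.
Proof.
exact: (assoc_stab Mcoord coordM part1_coords part2_coords part3_coords
  J12 J13 J23 G1_0 G2_0 (fun p => part_aff_coords ik' i3 HiE (p := p)) J12i
  (TD_part_card TD PE ik1) (TD_part_card TD PE ik')).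
Qed.

Lemma parti_neq : a != 0 /\ a != 1.
Proof.
case: emb => -[_ H_inj] _ _ _ _.
have Hi j : index_range 1 k j -> i <> j -> H i <> H j.
  by move=> jk ij /H_inj ij'; apply: ij; apply: ij'; rewrite inE.
split; apply/eqP => aE; move: HiE; rewrite aE ?scale0r ?subr0 ?scale1r.
  by rewrite -H1E; apply: (Hi _ ik1) => i1; move: ik; rewrite i1 => /andP[].
by rewrite -H2E; apply: (Hi _ ik2) => i2; move: ik; rewrite i2 => /andP[].
Qed.

End OtherParts.
End NormalForm.

(** * Designs with at least four parts *)

Section FirstPart.
Variable D : unitRingType.
Hypothesis hD : GRing.field_axiom D.
Variables (m k n : nat).
Local Notation pt := (ppoint D m.+1).
Variables (V : set pt) (P B : set (set pt)) (H : nat -> set pt) (ell : set pt -> set pt).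
Hypothesis TD : is_TD k n V P B.
Hypothesis emb : embedded k V P B H ell.
Hypotheses (prop : is_proper V) (k_ge4 : (4 <= k)%N).
Local Notation evp f p := (ev f (pvec hD p)).
Local Notation W i := (V `&` H i).

Lemma emb_coaxial12 (F : nat -> 'rV[D]_m.+2) i v :
  (forall i, index_range 1 k i -> F i != 0 /\ H i = hpl hD (F i)) ->
  index_range 1 k i -> ev (F 1%N) v = 0 -> ev (F 2%N) v = 0 -> ev (F i) v = 0.
Proof.
move=> HF ik v1 v2.
have [->//|/eqP i1] := eqVneq i 1%N; have [->//|/eqP i2] := eqVneq i 2%N.
have le_k j : (0 < j <= 4)%N -> index_range 1 k j.
  by move=> /andP[j0 j4]; apply/andP; split=> //; apply: leq_trans k_ge4.
have [k1 k2 k3 k4] : [/\ index_range 1 k 1%N, index_range 1 k 2%N,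
    index_range 1 k 3%N & index_range 1 k 4%N] by split; exact: le_k.
have coax := emb_coaxial TD emb HF prop k1 k2 ik.
(* The centre of perspectivity must lie in a further part: the fourth when [i = 3], the third
   otherwise. *)
have [i3|/eqP i3] := eqVneq i 3%N.
  by apply: (coax 4%N) v1 v2 => //; first [exact: nesym|rewrite i3].
by apply: (coax 3%N) v1 v2 => //; exact: nesym.
Qed.

Lemma emb_frame : exists (M : 'M[D]_m.+2) (X : 'M[D]_(m, m.+2)) (fy fz : 'rV[D]_m.+2)
    (a : nat -> D) (x0 y0 : pt),
  [/\ is_basis M /\
      (forall x y z, [/\ X *m (M *m @hvec D m.+1 x y z) = x,
        ev fy (M *m @hvec D m.+1 x y z) = y & ev fz (M *m @hvec D m.+1 x y z) = z]),
      forall v, v = M *m @hvec D m.+1 (X *m v) (ev fy v) (ev fz v),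
      [/\ H 1%N = hpl hD fy, H 2%N = hpl hD (fy - fz) & H 3%N = hpl hD fz],
      forall i, index_range 4 k i -> H i = hpl hD (fy - a i *: fz)
    & [/\ W 1%N x0, @has_coords D m.+1 M 0 0 1 x0,
          W 2%N y0 & @has_coords D m.+1 M 0 1 1 y0]] /\
  subspace m [set v | ev fy v = 0 /\ ev fz v = 0].
Proof.
have le_k j : (0 < j <= 4)%N -> index_range 1 k j.
  by move=> /andP[j0 j4]; apply/andP; split=> //; apply: leq_trans k_ge4.
have [k1 k2 k3 k4] : [/\ index_range 1 k 1%N, index_range 1 k 2%N,
    index_range 1 k 3%N & index_range 1 k 4%N] by split; exact: le_k.
have PE : P = [set W i | i in index_range 1 k] by case: emb.
have [F HF] := emb_forms hD emb.
have [x0 Wx0] := emb_part_neq0 TD emb k1.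
have [y0 Wy0] := emb_part_neq0 TD emb k2.
have [z0 Wz0 [s [t zE]]] := emb_join hD TD emb k1 k2 k3 (ltac:(done)) Wx0 Wy0.
have s0 : s != 0.
  apply/eqP => s0; apply: (emb_neq TD emb k3 k2 _ Wz0 Wy0) => //.
  by apply: (@pvec_inj D hD _ _ _ t); rewrite zE s0 rscale0 add0r.
have t0 : t != 0.
  apply/eqP => t0; apply: (emb_neq TD emb k3 k1 _ Wz0 Wx0) => //.
  by apply: (@pvec_inj D hD _ _ _ s); rewrite zE t0 rscale0 addr0.
have off i j x := @emb_off_neq0 D hD m k n V P B H ell TD emb F HF i j x.
have on i x := @emb_on D hD m k V H F HF i x.
have F1 : F 1%N != 0 := (HF _ k1).1.
have [A Ai AE] : exists2 A : 'M[D]_(m.+2, m), col_indep A &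
    colspan A = [set v | ev (F 1%N) v = 0 /\ ev (F 2%N) v = 0].
  apply: (ker_two_forms hD F1); exists (pvec hD x0); first exact: on.
  exact: (off 1%N).
have A0 x i : index_range 1 k i -> ev (F i) (A *m x) = 0.
  move=> ik; have : colspan A (A *m x) by exists x.
  by rewrite AE => -[v1 v2]; apply: emb_coaxial12.
(* From [z0 = x0 s + y0 t] these representatives satisfy [u + w = y0 t]. With [u] and [w] as the
   last two basis vectors, [x0], [y0], [z0] become [[0, 0, 1]], [[0, 1, 1]], [[0, 1, 0]]. *)
pose u := pvec hD z0; pose w := - rscale (pvec hD x0) s.
have yE : u + w = rscale (pvec hD y0) t by rewrite /u /w zE addrAC subrr add0r.
pose M := frame A u w.
have Fu i : index_range 1 k i -> i <> 3%N -> ev (F i) u != 0.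
  by move=> ik i3; apply: (off 3%N) => // /esym.
have Fw i : index_range 1 k i -> i <> 1%N -> ev (F i) w != 0.
  move=> ik i1; rewrite evN oppr_eq0 ev_rscale skew_mul_neq0 //.
  by apply: (off 1%N) => // /esym.
have F1w : ev (F 1%N) w = 0 by rewrite evN ev_rscale (on 1%N) // mul0r oppr0.
have F3u : ev (F 3%N) u = 0 by apply: on.
have FM i x y z : index_range 1 k i -> ev (F i) (M *m @hvec D m.+1 x y z) =
    ev (F i) u * y + ev (F i) w * z.
  by move=> ik; rewrite frame_hvec !evD !ev_rscale A0 // add0r.
have F2 : ev (F 2%N) w = - ev (F 2%N) u.
  apply/eqP; rewrite -addr_eq0 addrC -evD yE ev_rscale.
  by rewrite (on 2%N) // mul0r.
have mul0 x y : x != 0 -> (x * y == 0 :> D) = (y == 0).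
  move=> x0'; apply/eqP/eqP => [/(skew_mul_eq0l hD x0')//|->]; exact: mulr0.
have Mi : col_indep M.
  move=> c Mc; have [x [y [z cE]]] := hvec_ex c.
  have y0' : y = 0.
    have := FM 1%N x y z k1; rewrite -cE Mc ev0 F1w mul0r addr0 => /esym/eqP.
    by rewrite mul0 ?Fu // => /eqP.
  have z0' : z = 0.
    have := FM 2%N x y z k2; rewrite -cE Mc ev0 y0' mulr0 add0r => /esym/eqP.
    by rewrite mul0 ?Fw // => /eqP.
  have x0' : x = 0.
    by apply: Ai; move: Mc; rewrite cE frame_hvec y0' z0' !rscale0 !addr0.
  by rewrite cE x0' y0' z0'; symmetry; apply: hvecP => *; rewrite mxE ?[RHS]mxE.
have Mb := indep_is_basis hD Mi.
have [X [fy [fz [Mcoord coordM]]]] := basis_coords Mb.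
have FE i v : index_range 1 k i ->
    ev (F i) v = ev (F i) u * ev fy v + ev (F i) w * ev fz v.
  by move=> ik; rewrite {1}[v]coordM FM.
have F1E v : (ev (F 1%N) v == 0) = (ev fy v == 0).
  by rewrite FE // F1w mul0r addr0 mul0 ?Fu.
have F2E v : (ev (F 2%N) v == 0) = (ev fy v - ev fz v == 0).
  by rewrite FE // F2 mulNr -mulrBr mul0 ?Fu.
have F3E v : (ev (F 3%N) v == 0) = (ev fz v == 0).
  by rewrite FE // F3u mul0r add0r mul0 ?Fw.
(* Factoring [F_i(u)] out on the left of [F_i(u) y + F_i(w) z] leaves [y - a_i z]. *)
pose a i := - ((ev (F i) u)^-1 * ev (F i) w).
have hpl_eq (f g : 'rV[D]_m.+2) : (forall v, (ev f v == 0) = (ev g v == 0)) ->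
    hpl hD f = hpl hD g.
  move=> fg; apply/seteqP; split=> p fp; apply/eqP; first by rewrite -fg; apply/eqP.
  by rewrite fg; apply/eqP.
exists M, X, fy, fz, a, x0, y0; split; [split|].
- by split.
- exact: coordM.
- rewrite (HF _ k1).2 (HF _ k2).2 (HF _ k3).2; split; apply: hpl_eq => v.
  + exact: F1E.
  + by rewrite evDl evNl F2E.
  + exact: F3E.
- move=> i /andP[i4 ik'].
  have ik : index_range 1 k i by apply/andP; split=> //; apply: leq_trans i4.
  have i3 : i <> 3%N by move=> i3; rewrite i3 in i4.
  have uFi := hD (Fu i ik i3).
  rewrite (HF _ ik).2; apply: hpl_eq => v; rewrite FE // evDl evNl evZl.
  have -> : ev (F i) u * ev fy v + ev (F i) w * ev fz v =
      ev (F i) u * (ev fy v - a i * ev fz v).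
    by rewrite mulrBr /a mulNr mulrN opprK -mulrA mulVKr.
  by rewrite mul0 ?Fu.
- split=> //; rewrite /has_coords colspan_cV frame_hvec mulmx0 add0r.
    rewrite rscale0 add0r rscale1; apply/(vecs_span hD).
      by rewrite oppr_eq0 rscale_neq0 ?pvec_neq0.
    exists (- s)^-1; first by rewrite skew_inv_neq0 ?oppr_eq0.
    by rewrite /w -rscaleNr rscaleK ?oppr_eq0.
  rewrite !rscale1 yE; apply/(vecs_span hD); first by rewrite rscale_neq0 ?pvec_neq0.
  by exists t^-1; rewrite ?skew_inv_neq0 ?rscaleK.
exists A => //; rewrite AE; apply/seteqP; split=> v /=.
  by move=> [yv zv]; split; apply/eqP; rewrite ?F1E ?F2E yv ?zv ?subrr.
move=> [/eqP + /eqP]; rewrite F1E F2E => /eqP ->.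
by rewrite sub0r oppr_eq0 => /eqP.
Qed.

Lemma card_stab_bound (S : set D) (a : nat -> D) q : S #= `I_q -> S 0 -> S 1 ->
  set_inj (index_range 4 k) a ->
  (forall i, index_range 4 k i -> [/\ S (a i), a i != 0 & a i != 1]) ->
  (k <= q + 1)%N.
Proof.
move=> Sq S0 S1 a_inj aS.
(* The list [0, 1, a_4, ..., a_k], of length [k - 1]: position 2 holds [a_4], hence the shift by
   two. *)
pose c i := match i with 0%N => 0 | 1%N => 1 | _ => a i.+2 end.
have cr i : (i.+2 < k.-1)%N -> index_range 4 k i.+4.
  by move=> ik; apply/andP; split=> //; rewrite -ltnS -(ltn_predK k_ge4) ltnS.
have c_inj : set_inj `I_k.-1 c.
  move=> [|[|i]] [|[|j]] /set_mem /= ik /set_mem /= jk //=.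
  - by move/esym/eqP; rewrite oner_eq0.
  - by have [_ + _] := aS _ (cr _ jk) => + /esym/eqP; move=> /negPf ->.
  - by move/eqP; rewrite oner_eq0.
  - by have [_ _ +] := aS _ (cr _ jk) => + /esym/eqP; move=> /negPf ->.
  - by have [_ + _] := aS _ (cr _ ik) => + /eqP; move=> /negPf ->.
  - by have [_ _ +] := aS _ (cr _ ik) => + /eqP; move=> /negPf ->.
  - by move/a_inj; rewrite !inE => /(_ (cr _ ik) (cr _ jk)) [->].
have cS : c @` `I_k.-1 `<=` S.
  move=> _ [[|[|i]] /= ik <-] //.
  by have [] := aS _ (cr _ ik).
have := subset_card_le cS.
rewrite (card_le_eql (inj_card_eq c_inj)) (card_le_eqr Sq) card_le_II.
by rewrite addn1 -ltnS prednK // (leq_trans _ k_ge4).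
Qed.

Hypotheses (m_gt0 : (0 < m)%N) (n_ge3 : (3 <= n)%N).

Lemma first_part :
  is_flat (m.-1) (\bigcap_(i in index_range 1 k) H i) /\
    exists (M : 'M[D]_m.+2) (G : set 'cV[D]_m) (a : nat -> D),
      [/\ is_basis M,
          is_subgroup G /\ G #= `I_n,
          set_inj (index_range 4 k) a /\
          (forall i, index_range 4 k i ->
             [/\ stab_scalars G (a i), a i != 0 & a i != 1]),
          [/\ H 1%N = @locus D m.+1 M (fun _ y _ => y = 0),
              H 2%N = @locus D m.+1 M (fun _ y z => y = z)
            & H 3%N = @locus D m.+1 M (fun _ _ z => z = 0)]
        & [/\ H 1%N `&` V = [set p | exists2 g, G g & @has_coords D m.+1 M g 0 1 p],
              H 2%N `&` V = [set p | exists2 g, G g & @has_coords D m.+1 M g 1 1 p],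
              H 3%N `&` V = [set p | exists2 g, G g & @has_coords D m.+1 M (- g) 1 0 p]
            & forall i, index_range 4 k i ->
                H i `&` V =
                  [set p | exists2 g, G g & @has_coords D m.+1 M g (a i) 1 p]]] /\
      exists p e t : nat,
        [/\ prime p /\ n = (p ^ e)%N,
            exists f : {additive 'rV['Z_p]_e -> 'cV[D]_m},
              injective f /\ range f = G,
            stab_scalars G #= `I_(p ^ t)%N,
            (t <= e)%N
          & (k <= p ^ t + 1)%N].
Proof.
have [M [X [fy [fz [a [x0 [y0 [[[Mb Mcoord] coordM [H1 H2 H3] Ha [Wx0 x0E Wy0 y0E]] sub]]]]]]]] :=
  emb_frame.
have [k1 k2] : index_range 1 k 1%N /\ index_range 1 k 2%N.
  by split; apply/andP; split=> //; apply: leq_trans k_ge4.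
split.
  exists [set v | ev fy v = 0 /\ ev fz v = 0]; first by rewrite prednK.
  have [F HF] := emb_forms hD emb.
  have memH i p : index_range 1 k i -> H i p <-> evp (F i) p = 0.
    by move=> ik; rewrite (HF _ ik).2.
  apply/seteqP; split=> p.
    move=> pH v; rewrite vecsE => -[c _ <-] /=; rewrite !ev_rscale.
    have yp : evp fy p = 0 by have := pH _ k1; rewrite H1.
    have : hpl hD (fy - fz) p by rewrite -H2; apply: pH.
    rewrite /hpl /= evDl evNl yp sub0r => /eqP; rewrite oppr_eq0 => /eqP zp.
    by rewrite zp !mul0r.
  move=> /(_ _ (pvec_in hD p)) /= [yp zp] i ik /=.
  have p1 : evp (F 1%N) p = 0 by apply/memH => //; rewrite H1.
  have p2 : evp (F 2%N) p = 0.
    by apply/memH => //; rewrite H2 /hpl /= evDl evNl yp zp subrr.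
  by apply/memH => //; apply: emb_coaxial12.
pose G := assoc_group V H M.
have Gsub : is_subgroup G := assoc_group_subgroup TD emb Mcoord coordM H1 H2 H3 Wx0 x0E Wy0 y0E.
have Gn : G #= `I_n := assoc_group_card TD emb Mcoord coordM H1 H3.
have n_gt1 : (1 < n)%N by apply: ltnW n_ge3.
have a_stab i : index_range 4 k i -> [/\ stab_scalars G (a i), a i != 0 & a i != 1].
  move=> ik; have [] := parti_neq TD emb H1 H2 ik (Ha i ik); split=> //.
  exact: (parti_stab TD emb Mcoord coordM H1 H2 H3 Wx0 x0E Wy0 y0E ik (Ha i ik)).
have a_inj : set_inj (index_range 4 k) a.
  move=> i j /set_mem ik /set_mem jk aij; case: emb => -[_ H_inj] _ _ _ _.
  have r4 l : index_range 4 k l -> l \in index_range 1 k.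
    by move=> /andP[l4 lk]; rewrite inE; apply/andP; split=> //; apply: leq_trans l4.
  by apply: H_inj; rewrite ?r4 // (Ha i ik) (Ha j jk) aij.
exists M, G, a; split.
  split=> //.
    by split; rewrite ?(locus_y hD Mcoord coordM) ?(locus_yz hD Mcoord coordM)
      ?(locus_z hD Mcoord coordM).
  split; [rewrite setIC|rewrite setIC|rewrite setIC|move=> i ik; rewrite setIC].
  - exact: (part1E TD emb Mcoord coordM H1 H3).
  - exact: (part2E TD emb Mcoord coordM H1 H2 H3 Wx0 x0E Wy0 y0E).
  - exact: (part3E TD emb Mcoord coordM H1 H3 Wy0 y0E).
  - exact: (partiE TD emb Mcoord coordM H1 H2 H3 Wx0 x0E Wy0 y0E ik (Ha i ik)).
have [p [e [t [pe fE Sq te]]]] := stab_primepower hD Gn Gsub n_gt1.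
exists p, e, t; split=> //.
by apply: card_stab_bound Sq _ _ a_inj a_stab; [exact: stab0|exact: stab1].
Qed.

End FirstPart.

(** * The extended design *)

Section Extension.
Variable D : unitRingType.
Hypothesis hD : GRing.field_axiom D.
Variables (m n : nat).
Local Notation pt := (ppoint D m.+1).
Variables (V : set pt) (P B : set (set pt)) (H : nat -> set pt) (ell : set pt -> set pt).
Hypothesis TD : is_TD 3 n V P B.
Hypothesis emb : embedded 3 V P B H ell.
Local Notation evp f p := (ev f (pvec hD p)).
Local Notation W i := (V `&` H i).
Variables (M : 'M[D]_m.+2) (X : 'M[D]_(m, m.+2)) (fy fz : 'rV[D]_m.+2).
Hypothesis Mcoord : forall x y z, [/\ X *m (M *m @hvec D m.+1 x y z) = x,
  ev fy (M *m @hvec D m.+1 x y z) = y & ev fz (M *m @hvec D m.+1 x y z) = z].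
Hypothesis coordM : forall v, v = M *m @hvec D m.+1 (X *m v) (ev fy v) (ev fz v).
Local Notation hv := (@hvec D m.+1).
Hypotheses (H1E : H 1%N = hpl hD fy) (H2E : H 2%N = hpl hD (fy - fz))
  (H3E : H 3%N = hpl hD fz).
Variable G : set 'cV[D]_m.
Hypotheses (Ggrp : is_subgroup G) (Gn : G #= `I_n).
Hypothesis W1E : W 1%N = [set p | exists2 g, G g & @has_coords D m.+1 M g 0 1 p].
Hypothesis W2E : W 2%N = [set p | exists2 g, G g & @has_coords D m.+1 M g 1 1 p].
Hypothesis W3E : W 3%N = [set p | exists2 g, G g & @has_coords D m.+1 M (- g) 1 0 p].
Variables (r : nat) (a : nat -> D).
Hypothesis a_bij : set_bij `I_r [set c | stab_scalars G c /\ c != 0 /\ c != 1] a.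
Local Notation K := (r + 3)%N.
Local Notation S := (stab_scalars G).

(* The hyperplane of index [i] is [y = height i * z], except that the one of
   index 3 is [z = 0]. *)
Definition height i := match i with 0 | 1 | 3 => 0 | 2 => 1 | l.+4 => a l end.

Lemma height_stab i : index_range 1 K i -> S (height i).
Proof.
have S0 := stab0 Ggrp; have S1 := @stab1 D m G.
case: i => [|[|[|[|i]]]] //= /andP[_ iK].
have [a_fun _ _] := a_bij; apply: (a_fun i _).1.
by rewrite /= -(ltn_add2r 3) addn3.
Qed.

Lemma height_inj i j : index_range 1 K i -> index_range 1 K j -> i <> 3%N -> j <> 3%N ->
  height i = height j -> i = j.
Proof.
have [a_fun a_inj _] := a_bij.
have ar l : index_range 1 K l.+4 -> (l < r)%N.
  by move=> /andP[_ lK]; rewrite -(ltn_add2r 3) addn3.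
have a0 l : index_range 1 K l.+4 -> a l <> 0.
  by move=> /ar lr; apply/eqP; apply: (a_fun l lr).2.1.
have a1 l : index_range 1 K l.+4 -> a l <> 1.
  by move=> /ar lr; apply/eqP; apply: (a_fun l lr).2.2.
have o0 : 1 <> 0 :> D by apply/eqP; rewrite oner_neq0.
case: i => [|[|[|[|i]]]] //; case: j => [|[|[|[|j]]]] //= iK jK _ _.
- by move=> /esym E; case: o0.
- by move=> /esym E; case: (a0 _ jK).
- by move=> /esym E; case: (a1 _ jK).
- by move=> E; case: (a0 _ iK).
- by move=> E; case: (a1 _ iK).
- by move/a_inj; rewrite !inE /= !ar // => /(_ isT isT) ->.
Qed.

(** Index 3 takes [g], not [- g] as in the normal form; the part is the same because [G = - G], and
    [g] then serves directly as the slope of a line. *)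
Definition ext_vec i (g : 'cV[D]_m) := if i == 3%N then hv g 1 0 else hv g (height i) 1.

Definition ext_form i := if i == 3%N then fz else fy - height i *: fz.

Let Yh x y z : ev fy (M *m hv x y z) = y. Proof. by have [] := Mcoord x y z. Qed.
Let Zh x y z : ev fz (M *m hv x y z) = z. Proof. by have [] := Mcoord x y z. Qed.
Let Xh x y z : X *m (M *m hv x y z) = x. Proof. by have [] := Mcoord x y z. Qed.

Lemma ext_vec_neq0 i g : M *m ext_vec i g != 0.
Proof.
by rewrite /ext_vec; case: ifP => _; apply: (coord_neq0 Mcoord);
  [constructor 2|constructor 3]; rewrite oner_neq0.
Qed.

Lemma ext_point_ex : exists Pt : nat -> 'cV[D]_m -> pt,
  forall i g, vecs (Pt i g) = range (rscale (M *m ext_vec i g)).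
Proof.
have /choice[Pt PtE] : forall ig : nat * 'cV[D]_m, exists p : pt,
    vecs p = range (rscale (M *m ext_vec ig.1 ig.2)).
  by move=> [i g]; apply: (span_point hD); apply: ext_vec_neq0.
by exists (fun i g => Pt (i, g)) => i g; rewrite PtE.
Qed.

Let Pt := projT1 (cid ext_point_ex).
Let vecs_Pt i g : vecs (Pt i g) = range (rscale (M *m ext_vec i g)).
Proof. by rewrite /Pt; case: cid => /= Q ->. Qed.

Let Pt_vec i g : exists2 c, c != 0 & pvec hD (Pt i g) = rscale (M *m ext_vec i g) c.
Proof. by apply/(vecs_span hD); [apply: ext_vec_neq0|apply: vecs_Pt]. Qed.

Let Pt_coords i g p : i <> 3%N -> @has_coords D m.+1 M g (height i) 1 p <-> p = Pt i g.
Proof.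
move=> /eqP i3; rewrite /has_coords colspan_cV; split=> [pE|->].
  by apply: ppoint_eq; rewrite pE vecs_Pt /ext_vec (negPf i3).
by rewrite vecs_Pt /ext_vec (negPf i3).
Qed.

Let Pt_coords3 g p : @has_coords D m.+1 M g 1 0 p <-> p = Pt 3%N g.
Proof.
rewrite /has_coords colspan_cV; split=> [pE|->]; last by rewrite vecs_Pt.
by apply: ppoint_eq; rewrite pE vecs_Pt.
Qed.

Let Pt_inj i g h : Pt i g = Pt i h -> g = h.
Proof.
move=> E; have [c c0 vE] := Pt_vec i g.
have /(vecs_span hD _ (ext_vec_neq0 i h))[e e0] := vecs_Pt i h.
rewrite -E vE /ext_vec.
case: ifP => _ vv; have := congr1 (mulmx X) vv; rewrite !mulmx_rscale !Xh.
  have := congr1 (ev fy) vv; rewrite !ev_rscale !Yh !mul1r => -> gh.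
  by rewrite -(rscaleK hD g e0) gh rscaleK.
have := congr1 (ev fz) vv; rewrite !ev_rscale !Zh !mul1r => -> gh.
by rewrite -(rscaleK hD g e0) gh rscaleK.
Qed.

Definition ext_part i := Pt i @` G.
Definition ext_plane i := hpl hD (ext_form i).
Definition ext_points : set pt := \bigcup_(i in index_range 1 K) ext_part i.

(** Since the heights are distinct, each new point determines its index; disjointness of the parts
    and distinctness of the hyperplanes both follow from this. *)
Let Pt_plane i j g : index_range 1 K i -> index_range 1 K j ->
  ext_plane j (Pt i g) <-> i = j.
Proof.
move=> iK jK; have [c c0 vE] := Pt_vec i g.
have -> : ext_plane j (Pt i g) <-> ev (ext_form j) (M *m ext_vec i g) = 0.
  rewrite /ext_plane /hpl /= vE ev_rscale; split=> [|->]; last by rewrite mul0r.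
  exact: skew_mul_eq0r c0.
have o0 : 1 <> 0 :> D by apply/eqP; rewrite oner_neq0.
rewrite /ext_form /ext_vec; have [->|/eqP j3] := eqVneq j 3%N.
  have [->|/eqP i3] := eqVneq i 3%N; first by rewrite Zh.
  by rewrite Zh; split=> // /o0.
have [->|/eqP i3] := eqVneq i 3%N.
  rewrite evDl evNl evZl Yh Zh mulr0 subr0; split=> [/o0//|j3'].
  by case: j3.
rewrite evDl evNl evZl Yh Zh mulr1; split=> [/eqP|->]; last by rewrite subrr.
by rewrite subr_eq0 => /eqP; apply: height_inj.
Qed.

Let ik i : index_range 1 3 i -> index_range 1 K i.
Proof. by move=> /andP[i0 i3]; apply/andP; split=> //; apply: leq_trans (leq_addl _ _). Qed.

Lemma ext_plane123 i : index_range 1 3 i -> ext_plane i = H i.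
Proof.
rewrite /ext_plane /ext_form; case: i => [|[|[|[|i]]]] //= _.
- by rewrite scale0r subr0 H1E.
- by rewrite scale1r H2E.
Qed.

Lemma ext_part123 i : index_range 1 3 i -> ext_part i = W i.
Proof.
case: i => [|[|[|[|i]]]] //= _.
- rewrite W1E; apply/seteqP; split=> [_ [g Gg <-]|p [g Gg gp]].
    by exists g => //; apply/(Pt_coords (i := 1%N)).
  by exists g => //; symmetry; apply/Pt_coords.
- rewrite W2E; apply/seteqP; split=> [_ [g Gg <-]|p [g Gg gp]].
    by exists g => //; apply/(Pt_coords (i := 2%N)).
  by exists g => //; symmetry; apply/Pt_coords.
- rewrite W3E; apply/seteqP; split=> [_ [g Gg <-]|p [g Gg gp]].
    by exists (- g); [exact: subgroup_opp|rewrite opprK; apply/Pt_coords3].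
  by exists (- g); [exact: subgroup_opp|symmetry; apply/Pt_coords3].
Qed.

Lemma ext_partE i : index_range 1 K i -> ext_part i = ext_points `&` ext_plane i.
Proof.
move=> iK; apply/seteqP; split=> [_ [g Gg <-]|_ [[j jK [g Gg <-]]]].
  by split; [exists i => //; exists g|apply/Pt_plane].
by move=> /(Pt_plane _ jK iK) <-; exists g.
Qed.

Let PE : P = [set W i | i in index_range 1 3]. Proof. by case: emb. Qed.
Let k1 : index_range 1 3 1%N. Proof. by []. Qed.
Let k2 : index_range 1 3 2%N. Proof. by []. Qed.
Let k3 : index_range 1 3 3%N. Proof. by []. Qed.

(* The points of the line through [g, 0, 1] and [t, 1, 0]. *)
Let line_coord i g t : 'cV[D]_m := if i == 3%N then t else g + rscale t (height i).

Let line_coord_in i g t : index_range 1 K i -> G g -> G t -> G (line_coord i g t).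
Proof.
move=> iK Gg Gt; rewrite /line_coord; case: ifP => // _.
by apply: subgroup_add => //; apply: height_stab.
Qed.

Let ext_vec_line i g t : i <> 3%N ->
  ext_vec i (line_coord i g t) = ext_vec 1%N g + rscale (ext_vec 3%N t) (height i).
Proof.
move=> /eqP/negPf i3; rewrite /ext_vec /line_coord i3 /=; symmetry; apply: hvecP => [j||];
  rewrite mxE [rscale _ _ _ _]mxE ?hvecX ?hvecY ?hvecZ ?mul1r ?mul0r ?add0r ?addr0 //.
by rewrite !mxE.
Qed.

Let line_coord_join i g t : joinline hD (Pt 1%N g) (Pt 3%N t) (Pt i (line_coord i g t)).
Proof.
have [i3|i3] := pselect (i = 3%N).
  by rewrite i3 /line_coord eqxx; exists 0, 1; rewrite rscale0 rscale1 add0r.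
have Pt_vecV j h : exists c, M *m ext_vec j h = rscale (pvec hD (Pt j h)) c.
  have [c c0 ->] := Pt_vec j h; exists c^-1.
  by rewrite rscaleK.
have [c1 E1] := Pt_vecV 1%N g; have [c3 E3] := Pt_vecV 3%N t.
have [c _ cE] := Pt_vec i (line_coord i g t).
exists (c1 * c), (c3 * height i * c).
by rewrite cE ext_vec_line // mulmxDr mulmx_rscale E1 E3 rscaleDl !rscaleA ?mulrA.
Qed.

Let ell_line b : B b -> is_line (ell b) /\ b `<=` ell b.
Proof. by case: emb => _ _ + _ _ => /(_ b). Qed.

Let line_in_plane b i p q : B b -> index_range 1 K i -> p <> q ->
  ell b p -> ell b q -> ext_plane i p -> ext_plane i q -> ell b `<=` ext_plane i.
Proof.
move=> Bb iK pq lp lq ip iq z; have [bl _] := ell_line Bb.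
rewrite (line_joinE hD bl lp lq pq) => -[s [t zE]].
move: ip iq; rewrite /ext_plane /hpl /= zE evD !ev_rscale => -> ->.
by rewrite !mul0r addr0.
Qed.

Let block_coords b : B b -> exists g t, [/\ G g, G t, b (Pt 1%N g) & b (Pt 3%N t)].
Proof.
move=> Bb; have [x [bx]] := TD_block_meet TD PE Bb k1.
have [y [by_]] := TD_block_meet TD PE Bb k3.
rewrite -!ext_part123 // => -[t Gt tE] [g Gg gE].
by exists g, t; rewrite gE tE.
Qed.

Let ell_not_sub b i : B b -> index_range 1 K i -> ~ (ell b `<=` ext_plane i).
Proof.
move=> Bb iK sub; have [g [t [Gg Gt bg bt]]] := block_coords Bb.
have [_ bsub] := ell_line Bb.
have /(Pt_plane g (ik k1) iK) i1 := sub _ (bsub _ bg).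
by have /(Pt_plane t (ik k3) iK) := sub _ (bsub _ bt); rewrite -i1.
Qed.

(** The line joins some [[g, 0, 1]] to some [[t, 1, 0]], which gives a point of the new part. A
    second common point would put the whole line in the hyperplane, and with it points of two
    different parts. *)
Let ell_meet b i : B b -> index_range 1 K i ->
  exists2 x, ext_part i x & ell b `&` ext_plane i = [set x].
Proof.
move=> Bb iK; have [g [t [Gg Gt bg bt]]] := block_coords Bb.
have [bl bsub] := ell_line Bb.
have Pne : Pt 1%N g <> Pt 3%N t.
  move=> E; suff /(Pt_plane g (ik k1) (ik k3)) : ext_plane 3%N (Pt 1%N g) by [].
  by rewrite E; apply/Pt_plane => //; exact: ik.
have lb : ell b (Pt i (line_coord i g t)).
  rewrite (line_joinE hD bl (bsub _ bg) (bsub _ bt) Pne); exact: line_coord_join.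
have pi : ext_plane i (Pt i (line_coord i g t)) by apply/Pt_plane.
exists (Pt i (line_coord i g t)).
  by exists (line_coord i g t) => //; apply: line_coord_in.
apply/seteqP; split=> [p [lp ip]|_ ->]; last by split.
apply: contrapT => pP.
exact: (ell_not_sub Bb iK (line_in_plane Bb iK pP lp lb ip pi)).
Qed.

(** No lines are added: a [TD(k, n)] has [n^2] blocks whatever [k] is, so each old block only gains
    points. *)
Definition ext_blocks : set (set pt) := [set ell b `&` ext_points | b in B].

Let points_sub : V `<=` ext_points.
Proof.
move=> x Vx; have [i i3 Wx] := TD_part_cover TD PE Vx.
by exists i; [exact: ik|rewrite ext_part123].
Qed.

Let ell_points b : B b -> ell b `&` V = b.
Proof.
move=> Bb; have [bl bsub] := ell_line Bb.
have bV : b `<=` V by case: TD => _ _ _ /(_ b Bb)[].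
apply/seteqP; split=> [x [lx Vx]|x bx]; last by split; [exact: bsub|exact: bV].
have [i i3 Wx] := TD_part_cover TD PE Vx.
have [y [by_ Wy]] := TD_block_meet TD PE Bb i3.
have [z _ lz] := ell_meet Bb (ik i3).
have memz p : b p \/ p = x -> W i p -> p = z.
  move=> bp [_ Hp]; suff : (ell b `&` ext_plane i) p by rewrite lz.
  by split; [case: bp => [/bsub//|->]|rewrite ext_plane123].
by rewrite (memz x (or_intror erefl) Wx) -(memz y (or_introl by_) Wy).
Qed.

Let ext_block_meet b i : ext_blocks b -> index_range 1 K i ->
  exists x, b `&` ext_part i = [set x].
Proof.
move=> [b0 Bb <-] iK; have [x Wx lx] := ell_meet Bb iK.
exists x; rewrite -lx; apply/seteqP; split=> p.
  by rewrite ext_partE // => -[[lp _] [_ ip]].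
move=> pli; have px : p = x by move: pli; rewrite lx.
case: pli => lp ip; split; last by rewrite px.
by split=> //; exists i => //; rewrite px.
Qed.

Let line_through i j p q : index_range 1 K i -> index_range 1 K j -> i <> j ->
  G p -> G q -> exists g t, [/\ G g, G t, line_coord i g t = p & line_coord j g t = q].
Proof.
move=> iK jK ij Gp Gq; rewrite /line_coord.
have Sa l s : index_range 1 K l -> G s -> G (rscale s (height l)).
  by move=> lK; apply: height_stab.
have [i3|/eqP i3] := eqVneq i 3%N.
  have [j3|/eqP j3] := eqVneq j 3%N; first by rewrite i3 j3 in ij.
  exists (q - rscale p (height j)), p; split=> //; last by rewrite subrK.
  by apply: Ggrp.2 => //; apply: Sa.
have [j3|/eqP j3] := eqVneq j 3%N.
  exists (p - rscale q (height i)), q; split=> //; last by rewrite subrK.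
  by apply: Ggrp.2 => //; apply: Sa.
have ne : height i - height j != 0.
  by rewrite subr_eq0; apply/eqP => /(height_inj iK jK i3 j3).
(* Solution of [g + t h_i = p], [g + t h_j = q]. It lies in [G] because the difference of two
   heights is a nonzero element of [D_G], whose inverse is in [D_G] too. *)
pose t := rscale (p - q) (height i - height j)^-1.
have Gt : G t.
  apply: (stabV hD Gn _ ne); last exact: Ggrp.2.
  by apply: stabB => //; apply: height_stab.
exists (p - rscale t (height i)), t; split=> //; last first.
- have tE : rscale t (height i) = p - q + rscale t (height j).
    apply/eqP; rewrite -subr_eq -rscaleNr -rscaleDr; apply/eqP.
    by rewrite /t rscaleVK.
  by rewrite tE opprD addrA subrK opprB addrC subrK.
- by rewrite subrK.
- by apply: Ggrp.2 => //; apply: Sa.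
Qed.

(** The line through [x] and [y] already carries an old block: the parameters [g], [t] of the line
    name one old point on [H_1] and one on [H_3], and the block joining these has that line. *)
Let ext_block_join i j x y : index_range 1 K i -> index_range 1 K j -> i <> j ->
  ext_part i x -> ext_part j y -> exists! b, ext_blocks b /\ b x /\ b y.
Proof.
move=> iK jK ij [p Gp xE] [q Gq yE].
have xy : x <> y.
  move=> xy; apply: ij; apply/(Pt_plane p iK jK); rewrite xE xy -yE.
  exact/Pt_plane.
have xV : ext_points x by exists i => //; exists p.
have yV : ext_points y by exists j => //; exists q.
have [g [t [Gg Gt gp tq]]] := line_through iK jK ij Gp Gq.
have W1g : W 1%N (Pt 1%N g) by rewrite -ext_part123 //; exists g.
have W3t : W 3%N (Pt 3%N t) by rewrite -ext_part123 //; exists t.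
have n13 : 1%N <> 3%N by [].
have [b [[Bb [bg bt]] _]] := TD_join TD PE k1 k3 n13 W1g W3t.
have [bl bsub] := ell_line Bb.
have ne : Pt 1%N g <> Pt 3%N t := emb_neq TD emb k1 k3 n13 W1g W3t.
have lE := line_joinE hD bl (bsub _ bg) (bsub _ bt) ne.
have lx : ell b x by rewrite lE -xE -gp; exact: line_coord_join.
have ly : ell b y by rewrite lE -yE -tq; exact: line_coord_join.
exists (ell b `&` ext_points); split.
  by split; [exists b|split; split].
move=> _ [[b' Bb' <-] [[lx' _] [ly' _]]].
have [bl' _] := ell_line Bb'.
by rewrite (line_joinE hD bl' lx' ly' xy) (line_joinE hD bl lx ly xy).
Qed.

Lemma extension :
  [/\ is_TD K n ext_points [set ext_part i | i in index_range 1 K] ext_blocks,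
      TD_extends V P B ext_points [set ext_part i | i in index_range 1 K] ext_blocks,
      embedded K ext_points [set ext_part i | i in index_range 1 K] ext_blocks
        ext_plane (fun b => ell (b `&` V))
    & forall i, index_range 1 3 i -> ext_plane i = H i].
Proof.
(* The line of a new block is recovered from its trace on [V], which is the old block. *)
have ellE b : B b -> ell (ell b `&` ext_points `&` V) = ell b.
  by move=> Bb; rewrite -setIA (setIidr points_sub) ell_points.
split; last exact: ext_plane123.
- apply: TD_of_parts; first exact: leq_addl.
  + by case: TD => -[].
  + by move=> i iK; apply: card_inj_image Gn => g h _ _; apply: Pt_inj.
  + move=> i j x iK jK [g Gg <-] [h Gh E]; apply/(Pt_plane g iK jK).
    by rewrite -E; apply/Pt_plane.
  + by move=> _ [b Bb <-] x [].
  + exact: ext_block_meet.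
  + exact: ext_block_join.
- split; first exact: points_sub.
    rewrite PE => _ [i i3 <-]; exists i; first exact: ik.
    exact: ext_part123.
  apply/seteqP; split=> [b Bb|_ [_ [b Bb <-] <-]].
    exists (ell b `&` ext_points); first by exists b.
    by rewrite -setIA (setIidr points_sub) ell_points.
  by rewrite -setIA (setIidr points_sub) ell_points.
- split.
  + split=> [i iK|i j /set_mem iK /set_mem jK ij].
      apply/(is_hyperplaneP hD); exists (ext_form i) => //; rewrite /ext_form.
      case: ifP => _; apply/eqP => f0.
        have := Zh 0 0 1; rewrite f0 /ev mul0mx mxE => /esym/eqP.
        by rewrite oner_eq0.
      have : ev (fy - height i *: fz) (M *m hv 0 1 0) = 1.
        by rewrite evDl evNl evZl Yh Zh mulr0 subr0.
      by rewrite f0 /ev mul0mx mxE => /esym/eqP; rewrite oner_eq0.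
    by apply/(Pt_plane 0 iK jK); rewrite -ij; apply/Pt_plane.
  + by apply/seteqP; split=> _ [i iK <-]; exists i => //; rewrite ext_partE.
  + move=> _ [b Bb <-]; rewrite ellE //; split; last by move=> x [].
    by case: emb => _ _ /(_ b Bb)[].
  + move=> _ _ /set_mem[b Bb <-] /set_mem[b' Bb' <-]; rewrite !ellE //.
    by move=> ->.
  + by move=> _ i [b Bb <-] iK; rewrite ellE //; apply: ell_not_sub.
Qed.

End Extension.

(** * Extending a Latin square by its associated group *)

Section SecondPart.
Variable D : unitRingType.
Hypothesis hD : GRing.field_axiom D.
Variables (m n : nat).
Local Notation pt := (ppoint D m.+1).
Variables (V : set pt) (P B : set (set pt)) (H : nat -> set pt) (ell : set pt -> set pt).
Hypothesis TD : is_TD 3 n V P B.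
Hypothesis emb : embedded 3 V P B H ell.
Local Notation evp f p := (ev f (pvec hD p)).
Local Notation W i := (V `&` H i).
Local Notation hv := (@hvec D m.+1).

Lemma hvec_split (x : 'cV[D]_m) (y z : D) :
  hv x y z = hv x 0 0 + rscale (hv 0 1 0) y + rscale (hv 0 0 1) z.
Proof.
symmetry; apply: hvecP => [j||]; rewrite mxE [(_ + _ : 'cV_ _) _ _]mxE
  [rscale _ y _ _]mxE [rscale _ z _ _]mxE ?hvecX ?hvecY ?hvecZ;
  by rewrite ?mxE ?mul0r ?mul1r ?add0r ?addr0.
Qed.

Lemma stab_enum (G : set 'cV[D]_m) : is_subgroup G -> G #= `I_n -> (1 < n)%N ->
  exists (r : nat) (a : nat -> D),
    set_bij `I_r [set c | stab_scalars G c /\ c != 0 /\ c != 1] a /\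
    stab_scalars G #= `I_(r + 2).
Proof.
move=> Ggrp Gn n1; have [q Sq _] := stab_card hD Gn n1.
set S' := [set c | _].
have /finite_setP[r Sr] : finite_set S'.
  apply: sub_finite_set (_ : S' `<=` stab_scalars G) _; first by move=> c [].
  by apply/finite_setP; exists q.
have [a a_bij] := card_enum (0 : D) Sr.
exists r, a; split=> //; have [a_fun a_inj a_surj] := a_bij.
pose c i := match i with 0%N => 0 | 1%N => 1 | l.+2 => a l end.
have ir i : (i.+2 < r + 2)%N -> (i < r)%N by rewrite addn2 !ltnS.
have -> : stab_scalars G = c @` `I_(r + 2).
  apply/seteqP; split=> [s Ss|_ [[|[|i]] /= ir' <-]].
  - have [->|s0] := eqVneq s 0; first by exists 0%N; rewrite //= addn2.
    have [->|s1] := eqVneq s 1; first by exists 1%N; rewrite //= addn2.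
    have [i /= ri <-] := a_surj s (conj Ss (conj s0 s1)).
    by exists i.+2; rewrite //= addn2 !ltnS.
  - exact: stab0.
  - exact: stab1.
  - by have [] := a_fun i (ir _ ir').
apply: card_inj_image (card_eqxx _).
have a0 i : (i.+2 < r + 2)%N -> a i <> 0.
  by move=> /ir ri; apply/eqP; apply: (a_fun i ri).2.1.
have a1 i : (i.+2 < r + 2)%N -> a i <> 1.
  by move=> /ir ri; apply/eqP; apply: (a_fun i ri).2.2.
have o0 : 1 <> 0 :> D by apply/eqP; rewrite oner_neq0.
move=> [|[|i]] [|[|j]] /set_mem /= iK /set_mem /= jK E //.
- by case: o0.
- by case: (a0 _ jK).
- by case: (a1 _ jK).
- by case: (a0 _ iK).
- by case: (a1 _ iK).
- by move: E => /a_inj; rewrite !inE /= !ir // => /(_ isT isT) ->.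
Qed.

Section AssociatedFrame.
Variables (M : 'M[D]_m.+2) (X : 'M[D]_(m, m.+2)) (fy fz : 'rV[D]_m.+2).
Hypothesis Mcoord : forall x y z, [/\ X *m (M *m hv x y z) = x,
  ev fy (M *m hv x y z) = y & ev fz (M *m hv x y z) = z].
Hypothesis coordM : forall v, v = M *m hv (X *m v) (ev fy v) (ev fz v).
Local Notation "''[' x , y , z ']' p" := (@has_coords D m.+1 M x y z p)
  (at level 8, x, y, z at level 99, p at level 8).
Hypothesis axis : H 1%N `&` H 2%N `&` H 3%N = [set p | exists x, '[x, 0, 0] p].
Variables (o1 o2 o3 : pt).
Hypotheses (W1 : W 1%N o1) (W2 : W 2%N o2) (W3 : W 3%N o3).
Hypotheses (o1E : '[0, 0, 1] o1) (o2E : '[0, 1, 1] o2) (o3E : '[0, 1, 0] o3).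

Let on_plane f x y z p : hpl hD f p -> '[x, y, z] p -> ev f (M *m hv x y z) = 0.
Proof.
move=> /vecs_sub_ker fp pE; apply: fp; rewrite pE.
by exists 1%:M => //; rewrite mulmx1.
Qed.

(** The coordinates are prescribed only through the axis and the points [o1], [o2], [o3]. Each [H_i]
    contains the axis, so its form is a combination of [fy] and [fz], and the point [o_i] on it
    fixes the ratio of the two coefficients. *)
Lemma associated_frame :
  [/\ H 1%N = hpl hD fy, H 2%N = hpl hD (fy - fz) & H 3%N = hpl hD fz].
Proof.
have [F HF] := emb_forms hD emb.
have k1 : index_range 1 3 1%N by [].
have k2 : index_range 1 3 2%N by [].
have k3 : index_range 1 3 3%N by [].
have FX i x : index_range 1 3 i -> ev (F i) (M *m hv x 0 0) = 0.
  move=> ik; have [->|x0] := eqVneq x 0.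
    have -> : hv 0 0 0 = 0 by symmetry; apply: hvecP => *; rewrite !mxE.
    by rewrite mulmx0 ev0.
  have [p pE] : exists p : pt, '[x, 0, 0] p by apply: (coord_point hD Mcoord); constructor 1.
  have [[p1 p2] p3] : (H 1%N `&` H 2%N `&` H 3%N) p by rewrite axis; exists x.
  have Hp : H i p by case: i ik => [|[|[|[|i]]]].
  by apply: on_plane pE; rewrite -(HF _ ik).2.
pose ey := M *m hv 0 1 0; pose ez := M *m hv 0 0 1.
have FE i v : index_range 1 3 i ->
    ev (F i) v = ev (F i) ey * ev fy v + ev (F i) ez * ev fz v.
  move=> ik; rewrite {1}[v]coordM hvec_split !mulmxDr !mulmx_rscale !evD !ev_rscale.
  by rewrite FX // add0r.
have mul0 x y : x != 0 -> (x * y == 0 :> D) = (y == 0).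
  by move=> x0; apply/eqP/eqP => [/(skew_mul_eq0l hD x0)//|->]; exact: mulr0.
have hpl_eq i g c : index_range 1 3 i -> (forall v, ev (F i) v = c * ev g v) ->
    H i = hpl hD g.
  move=> ik Fg; rewrite (HF _ ik).2.
  have c0 : c != 0.
    apply/eqP => c0; have := (HF _ ik).1; rewrite (ev_all0 (f := F i)) ?eqxx //.
    by move=> v; rewrite Fg c0 mul0r.
  apply/seteqP; split=> p; rewrite /hpl /= Fg => /eqP; last by move=> /eqP ->; rewrite mulr0.
  by rewrite mul0 // => /eqP.
have on i p : W i p -> index_range 1 3 i -> hpl hD (F i) p.
  by move=> [_ Hp] ik; rewrite -(HF _ ik).2.
have Fz1 : ev (F 1%N) ez = 0 := on_plane (on _ _ W1 k1) o1E.
have Fy3 : ev (F 3%N) ey = 0 := on_plane (on _ _ W3 k3) o3E.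
have F2 : ev (F 2%N) ez = - ev (F 2%N) ey.
  apply/eqP; rewrite -addr_eq0 addrC -evD -mulmxDr; apply/eqP.
  have -> : hv 0 1 0 + hv 0 0 1 = hv 0 1 1.
    by apply: hvecP => [j||]; rewrite mxE ?hvecX ?hvecY ?hvecZ ?mxE ?addr0 ?add0r.
  exact: on_plane (on _ _ W2 k2) o2E.
split.
- by apply: (hpl_eq _ _ (ev (F 1%N) ey)) => // v; rewrite FE // Fz1 mul0r addr0.
- apply: (hpl_eq _ _ (ev (F 2%N) ey)) => // v.
  by rewrite FE // F2 evDl evNl mulNr -mulrBr.
- by apply: (hpl_eq _ _ (ev (F 3%N) ez)) => // v; rewrite FE // Fy3 mul0r add0r.
Qed.

End AssociatedFrame.

Lemma second_part (G : set 'cV[D]_m) : @is_associated_group D m.+1 V B H G ->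
  exists2 q : nat, stab_scalars G #= `I_q &
    exists (V' : set pt) (P' B' : set (set pt)) (H' : nat -> set pt)
      (ell' : set pt -> set pt),
      [/\ is_TD (q + 1) n V' P' B', TD_extends V P B V' P' B',
          embedded (q + 1) V' P' B' H' ell'
        & forall i, index_range 1 3 i -> H' i = H i].
Proof.
move=> [o1 [o2 [o3 [M [[W1 W2 W3 _] Mb axis [o1E o2E o3E] GE]]]]].
have [X [fy [fz [Mcoord coordM]]]] := basis_coords Mb.
have [H1 H2 H3] := associated_frame Mcoord coordM axis W1 W2 W3 o1E o2E o3E.
(* [G] is read off all of [V], but a point [[g, 0, 1]] has [y = 0] and so lies on [H_1] anyway. *)
have {}GE : G = assoc_group V H M.
  rewrite GE; apply/seteqP; split=> g [p Vp gp]; exists p => //; last by case: Vp.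
  split=> //; rewrite H1; have [_ yp _] := iffLR (has_coords_aff hD Mcoord coordM _ _ _) gp.
  by rewrite /hpl /= yp mul0r.
have Ggrp : is_subgroup G.
  by rewrite GE; exact: (assoc_group_subgroup TD emb Mcoord coordM H1 H2 H3 W1 o1E W2 o2E).
have Gn : G #= `I_n by rewrite GE; exact: (assoc_group_card TD emb Mcoord coordM H1 H3).
have W1E := part1E TD emb Mcoord coordM H1 H3.
have W2E := part2E TD emb Mcoord coordM H1 H2 H3 W1 o1E W2 o2E.
have W3E := part3E TD emb Mcoord coordM H1 H3 W2 o2E.
rewrite -GE in W1E W2E W3E.
have n1 : (1 < n)%N by case: TD => -[_ /ltnW].
have [r [a [a_bij Sq]]] := stab_enum Ggrp Gn n1.
(* The [r] listed scalars together with 0 and 1 make up [D_G], so [|D_G| + 1] is the number [r + 3]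
   of parts constructed. *)
exists (r + 2)%N => //; rewrite -addnA.
by do 5 eexists; exact: (extension TD emb Mcoord H1 H2 H3 Ggrp Gn W1E W2E W3E a_bij).
Qed.

End SecondPart.

Theorem theorem17 (D : unitRingType) (hD : GRing.field_axiom D)
    (d : nat) (hd : (2 <= d)%N) :
  (forall (k n : nat) (V : set (ppoint D d)) (P B : set (set (ppoint D d)))
      (H : nat -> set (ppoint D d)) (ell : set (ppoint D d) -> set (ppoint D d)),
    (3 <= n)%N -> (4 <= k)%N ->
    is_TD k n V P B -> embedded k V P B H ell -> is_proper V ->
    is_flat (d - 2)%N (\bigcap_(i in index_range 1 k) H i) /\
    exists (M : 'M[D]_d.+1) (G : set 'cV[D]_d.-1) (a : nat -> D),
      [/\ is_basis M,
          is_subgroup G /\ G #= `I_n,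
          set_inj (index_range 4 k) a /\
          (forall i, index_range 4 k i ->
             [/\ stab_scalars G (a i), a i != 0 & a i != 1]),
          [/\ H 1%N = locus M (fun _ y _ => y = 0),
              H 2%N = locus M (fun _ y z => y = z)
            & H 3%N = locus M (fun _ _ z => z = 0)]
        & [/\ H 1%N `&` V = [set p | exists2 g, G g & has_coords M g 0 1 p],
              H 2%N `&` V = [set p | exists2 g, G g & has_coords M g 1 1 p],
              H 3%N `&` V = [set p | exists2 g, G g & has_coords M (- g) 1 0 p]
            & forall i, index_range 4 k i ->
                H i `&` V =
                  [set p | exists2 g, G g & has_coords M g (a i) 1 p]]] /\
      exists p m t : nat,
        [/\ prime p /\ n = (p ^ m)%N,
            exists f : {additive 'rV['Z_p]_m -> 'cV[D]_d.-1},
              injective f /\ range f = G,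
            stab_scalars G #= `I_(p ^ t)%N,
            (t <= m)%N
          & (k <= p ^ t + 1)%N]) /\
  (forall (n : nat) (V : set (ppoint D d)) (P B : set (set (ppoint D d)))
      (H : nat -> set (ppoint D d)) (ell : set (ppoint D d) -> set (ppoint D d))
      (infty : ppoint D d) (G : set 'cV[D]_d.-1),
    is_TD 3 n V P B -> is_transversal_point n V B ell infty ->
    embedded 3 V P B H ell -> is_proper V ->
    is_associated_group V B H G ->
    exists2 q : nat, stab_scalars G #= `I_q &
      exists (V' : set (ppoint D d)) (P' B' : set (set (ppoint D d)))
        (H' : nat -> set (ppoint D d))
        (ell' : set (ppoint D d) -> set (ppoint D d)),
        [/\ is_TD (q + 1) n V' P' B',
            TD_extends V P B V' P' B',
            embedded (q + 1) V' P' B' H' ell'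
          & forall i, index_range 1 3 i -> H' i = H i]).
Proof.
(* With [d = m.+2], vectors of [D^(d-1)] have [m.+1] entries, so the axis has linear dimension
   [m.+1] and projective dimension [m = d - 2]. *)
case: d hd => [|[|m]] // _; have dE : (m.+2 - 2)%N = m by rewrite subn2.
split=> [k n V P B H ell n3 k4 TD emb prop|n V P B H ell _ G TD _ emb _].
  by rewrite dE; exact: (first_part hD TD emb prop k4 (ltn0Sn m) n3).
exact: (second_part hD TD emb).
Qed.
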